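(* Let $n\ge2$ be an integer, let $A\subset[0,1)$ be measurable with $|A|=x$, and put $x^*=\min\{x,1-x\}$. Then $$\|S_1(\mathbbm 1_A)\|_1\ge\omega_n(x^* ),$$ and for $0<x<1$, $$\omega_n(x^* )\asymp_n x^*\log\frac1{x^*},$$ i.e. there are constants $0<c\le C<\infty$ depending only on $n$ with $c\,x^*\log(1/x^* )\le\omega_n(x^* )\le C\,x^*\log(1/x^* )$ for all $x\in(0,1)$. Moreover, the lower bound is sharp up to a constant: there exists a constant $c_n$ depending only on $n$ such that for $A_k=[0,n^{-k})$, $$\|S_1(\mathbbm 1_{A_k})\|_1=c_n\,\omega_n(n^{-k}),\qquad k\ge1.$$ For $n=2$, the lower bound is the dyadic Takagi lower bound: $\omega_2$ is the Takagi function $T(x)=\sum_{k=0}^\infty2^{-k}\operatorname{dist}(2^kx,\mathbb Z)$ on $[0,1]$.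
   Context: $[0,1)$ carries Lebesgue measure and $|A|$ denotes the Lebesgue measure of $A$. For $m\ge0$, let $\mathcal I_m=\{[k/n^m,(k+1)/n^m):k=0,\dots,n^m-1\}$ and $\mathcal N_m=\sigma(\mathcal I_m)$. For $f\in L^1[0,1)$ put $f_m=\mathbb E(f\mid\mathcal N_m)$ for $m\ge0$, $d_m=f_m-f_{m-1}$ for $m\ge1$, and $S_1(f)=\sum_{m\ge1}|d_m|$ (value $+\infty$ allowed); $\|\cdot\|_1$ is the $L^1[0,1)$ norm (possibly $+\infty$). The $n$-adic Takagi–van der Waerden function is $$\omega_n(x)=\sum_{k=0}^\infty\frac{\|n^kx\|_{1/n}}{n^k},\qquad \|t\|_{1/n}:=\min\{\operatorname{dist}(t,\mathbb Z),1/n\}.$$ *)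

(* Defs.v *)
From mathcomp Require Export all_boot all_order all_algebra.
From mathcomp Require Export all_classical all_reals all_analysis.

Set Implicit Arguments.
Unset Strict Implicit.
Unset Printing Implicit Defensive.

Import Order.TTheory GRing.Theory Num.Theory.
Import numFieldNormedType.Exports.

Local Open Scope classical_set_scope.
Local Open Scope ring_scope.

(** * Conditional expectation on a measurable set [D] *)

Section conditional_expectation.
Context d (T : measurableType d) (R : realType).
Variables (mu : {measure set T -> \bar R}) (D : set T).

(* [N] is meant to be a sub-sigma-algebra of the measurable subsets of [D];
   the first clause says that the restriction of [g] to [D] is measurable
   from [N] to the Borel sets. Values outside [D] are irrelevant. *)
Definition is_cond_exp (N : set (set T)) (f g : T -> R) : Prop :=
  [/\ preimage_set_system D g (measurable : set (set (measurableTypeR R)))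
        `<=` N,
      mu.-integrable D (EFin \o g) &
      forall B, N B ->
        (\int[mu]_(x in B) (g x)%:E = \int[mu]_(x in B) (f x)%:E)%E].

(* A chosen version of the conditional expectation (0 if there is none). *)
Definition cond_exp (N : set (set T)) (f : T -> R) : T -> R :=
  xget (cst 0) [set g | is_cond_exp N f g].

End conditional_expectation.

(** * The n-adic martingale on [0,1) *)

(* The real line with the sigma-algebra of Lebesgue measurable sets
   (by [completed_caratheodory_measurable], the completion of the Borel
   sigma-algebra), and Lebesgue measure on it. *)
Notation lebesgueType R :=
  (caratheodory_type (mu_ext (@wlength R idfun))).
Notation leb := completed_lebesgue_measure.

Section adic.
Context {R : realType}.
Implicit Types (n m : nat) (f : R -> R) (x t : R).

Definition unit_itv : set R := `[0, 1[.

Definition adic_itv n m : set (set R) :=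
  [set `[k%:R / n%:R ^+ m, k.+1%:R / n%:R ^+ m[%classic | k in `I_(n ^ m)].

Definition adic_algebra n m : set (set R) := <<s unit_itv, adic_itv n m >>.

Definition adic_exp n f m : R -> R :=
  cond_exp (@leb R) unit_itv (adic_algebra n m) f.

Definition adic_diff n f m : R -> R :=
  fun x => adic_exp n f m x - adic_exp n f m.-1 x.

Definition S1 n f : R -> \bar R :=
  fun x => (\sum_(1 <= m <oo) `|adic_diff n f m x|%:E)%E.

Definition L1norm (F : R -> \bar R) : \bar R :=
  (\int[@leb R]_(x in unit_itv) `|F x|)%E.

(** * Takagi-van der Waerden functions *)

Definition dist_int t : R := inf [set `|t - z%:~R| | z in [set: int]].

Definition omega n x : R :=
  limn (series (fun k =>
    Num.min (dist_int (n%:R ^+ k * x)) n%:R^-1 / n%:R ^+ k)).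

Definition takagi x : R :=
  limn (series (fun k => 2 ^- k * dist_int (2 ^+ k * x))).

Definition xstar x : R := Num.min x (1 - x).

End adic.

(* Main.v *)
Require Import Defs.
From mathcomp Require Import measurable_realfun.
From mathcomp Require Import zify ring lra.
Import Order.TTheory GRing.Theory Num.Theory.
Import numFieldNormedType.Exports.

Set Implicit Arguments.
Unset Strict Implicit.
Unset Printing Implicit Defensive.

(** By the martingale structure, the L1 norm of S_1(1_A) is the sum over m of
    the norms of d_m, which are read off the densities of A on the n-adic
    intervals.  If an interval has density y and its n children have densities
    x_j, then n omega(y) <= \sum_j omega(x_j) + \sum_j |x_j - y|
    ([omega_mean]), so the average of omega(density) over the intervals of
    level m decreases by at most the norm of d_(m+1) at each step.  It starts
    from omega(|A|), and it tends to 0 because A is approximated by finite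
    unions of intervals, so that most densities are close to 0 or 1, where
    omega vanishes.

    By continuity, [omega_mean] is a statement on integers, since
    n^M omega(s / n^M) = weight M s where weight (M+1) s is, up to a correction
    0 or 1, the sum of weight M over the n balanced parts of s.  It is proved
    by induction on M ([weight_sum]): with P_j the partial sums of a_0, a_1,
    and so on, the array
    floor((P_(j+1) + l) / n) - floor((P_j + l) / n), for 0 <= j, l < n, has the
    balanced parts of a_j in its j-th row, and its columns sum to the balanced
    parts of \sum_j a_j; one applies the induction hypothesis to the columns.
    For this to work the error term \sum_j |a_j - mean| has to be replaced by
    a smaller one: the sum of the distances from a_j to {g, g + 1}, plus 1 if
    there are a_j on both sides, for any integer g. *)

(** * The integer inequality *)

Section weight.
Local Open Scope nat_scope.
Variable n : nat.
Hypothesis n_gt0 : 0 < n.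

(** The numbers [(s + l) %/ n] for [l < n] are the balanced parts of [s]: they add up to [s] and any
    two of them differ by at most 1. *)
Fixpoint weight M s : nat :=
  if M is M'.+1 then \sum_(l < n) weight M' ((s + l) %/ n) + ~~ (n %| s) else 0.

(* The distance from [a] to [{g, g + 1}]: the subtractions are truncated. *)
Definition gap g a := (a - g.+1) + (g - a).

(** As [l] runs below [n], the quotient increases exactly once, at [l = n - a %% n], where [l]
    completes the remainder of [a] to [n]. *)
Lemma sum_ceil_div (f : nat -> nat) a :
  \sum_(l < n) f ((a + l) %/ n) =
  (n - a %% n) * f (a %/ n) + (a %% n) * f (a %/ n).+1.
Proof.
have rn := ltn_pmod a n_gt0.
rewrite -(big_mkord xpredT (fun l => f ((a + l) %/ n))).
rewrite (@big_cat_nat _ _ _ (n - a %% n)) ?leq_subr//=; congr (_ + _).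
  rewrite big_nat_cond (eq_bigr (fun=> f (a %/ n))) -?big_nat_cond.
    by rewrite sum_nat_const_nat subn0.
  move=> i /andP[/andP[_ hi] _]; congr f.
  rewrite {1}(divn_eq a n) -addnA divnMDl// [X in _ + X]divn_small; lia.
rewrite big_nat_cond (eq_bigr (fun=> f (a %/ n).+1)) -?big_nat_cond.
  rewrite sum_nat_const_nat; congr (_ * _); lia.
move=> i /andP[/andP[hi hin] _]; congr f.
rewrite {1}(divn_eq a n) -addnA divnMDl// -addn1; congr addn.
have -> : a %% n + i = 1 * n + (a %% n + i - n) by lia.
rewrite divnMDl// [X in _ + X]divn_small; lia.
Qed.

Lemma sum_ceil_divE a : \sum_(l < n) (a + l) %/ n = a.
Proof.
rewrite (sum_ceil_div id) [RHS](divn_eq a n).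
have rn := ltn_pmod a n_gt0; nia.
Qed.

Lemma divn_add_sub p a l :
  (p + a + l) %/ n - (p + l) %/ n = (a + (p + l) %% n) %/ n.
Proof.
have -> : p + a + l = (p + l) %/ n * n + (a + (p + l) %% n).
  by rewrite [X in _ = _ + X]addnC addnA -divn_eq; lia.
by rewrite divnMDl// addKn.
Qed.

(** By [divn_add_sub] the offset [p] matters only through [(p + l) %% n], and [l] to [(p + l) %% n]
    permutes the residues. So a row of the array consists of balanced parts in a rotated order. *)
Lemma sum_shift (f : nat -> nat) p a :
  \sum_(l < n) f ((p + a + l) %/ n - (p + l) %/ n) =
  \sum_(l < n) f ((a + l) %/ n).
Proof.
under eq_bigr do rewrite divn_add_sub.
pose h (l : 'I_n) := Ordinal (ltn_pmod (p + l) n_gt0).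
have hinj : injective h.
  move=> i j /(congr1 val)/= /eqP.
  rewrite eqn_modDl => /eqP.
  by rewrite !modn_small// => /ord_inj.
by rewrite [RHS](reindex_inj hinj).
Qed.

Lemma col_telescope k (a : nat -> nat) l : l < n ->
  \sum_(j < k) ((\sum_(i < j) a i + a j + l) %/ n - (\sum_(i < j) a i + l) %/ n)
  = (\sum_(j < k) a j + l) %/ n.
Proof.
move=> ln; elim: k => [|k IH]; first by rewrite !big_ord0 divn_small.
by rewrite big_ord_recr/= IH big_ord_recr/= subnKC// leq_div2r; lia.
Qed.

(** If [a] lies between [n * c] and [n * c.+1], all its parts are in [{c, c + 1}]. Otherwise no two
    parts lie strictly on opposite sides of this pair, so the distances add up without
    cancellation. *)
Lemma sum_gap_row c a :
  \sum_(l < n) gap c ((a + l) %/ n) = (a - n * c.+1) + (n * c - a).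
Proof.
rewrite (sum_ceil_div (gap c)) /gap.
have rn := ltn_pmod a n_gt0; have aE := divn_eq a n.
move: rn aE; move: (a %/ n) (a %% n) => q r rn ->.
have [h|h|h] := ssrnat.ltngtP q c.
- have -> : q - c.+1 = 0 by lia.
  have -> : q.+1 - c.+1 = 0 by lia.
  rewrite !add0n; nia.
- have -> : c - q = 0 by lia.
  have -> : c - q.+1 = 0 by lia.
  have -> : n * c - (q * n + r) = 0 by apply/eqP; rewrite subn_eq0; nia.
  have -> : q.+1 - c.+1 = (q - c.+1).+1 by lia.
  have [k ->] : exists k, q = c.+1 + k by exists (q - c.+1); lia.
  rewrite !addn0 addKn; nia.
- rewrite h; nia.
Qed.

Lemma sum_above_row c a :
  \sum_(l < n) (c < (a + l) %/ n) = minn (a - n * c) n.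
Proof.
rewrite (sum_ceil_div (fun x => c < x)).
have rn := ltn_pmod a n_gt0; have aE := divn_eq a n.
move: rn aE; move: (a %/ n) (a %% n) => q r rn ->.
have [h|h|h] := ssrnat.ltngtP q c; nia.
Qed.


Lemma ndvd_sum (a : 'I_n -> nat) :
  ~~ (n %| \sum_(j < n) a j) <= \sum_(j < n) ~~ (n %| a j).
Proof.
case: (boolP [forall j, n %| a j]) => [/forallP h|].
  by rewrite dvdn_sum// => j _; exact: h.
rewrite negb_forall => /existsP[j hj].
by rewrite [X in _ <= X](bigD1 j)//= hj; case: (~~ _); lia.
Qed.

Lemma ndvd_sum_neq (a : 'I_n -> nat) v :
  ~~ (n %| \sum_(j < n) a j) <= \sum_(j < n) (a j != v).
Proof.
case: (boolP [forall j, a j == v]) => [/forallP h|].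
  rewrite (eq_bigr (fun=> v)) => [|j _]; last exact/eqP.
  by rewrite sum_nat_const card_ord dvdn_mulr.
rewrite negb_forall => /existsP[j hj].
by rewrite [X in _ <= X](bigD1 j)//= hj; case: (~~ _); lia.
Qed.

Lemma sum_eq_neq (a : 'I_n -> nat) v :
  \sum_(j < n) (a j == v : nat) + \sum_(j < n) (a j != v) = n.
Proof.
rewrite -big_split/= (eq_bigr (fun=> 1)) ?sum_nat_const ?card_ord ?muln1//.
by move=> j _; case: (a j == v).
Qed.

Lemma ndvd_between c a : n * c < a < n * c + n -> ~~ (n %| a).
Proof.
move=> h; have -> : a = n * c + (a - n * c) by lia.
rewrite dvdn_addr ?dvdn_mulr//; apply/negP => /dvdn_leq; lia.
Qed.

(* [N] stands for the number of columns of the array that have entries on both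
   sides of [c]. *)
Lemma crossing_bound (a : 'I_n -> nat) g N (c := g %/ n) :
  N <= n -> N <= \sum_(j < n) minn (a j - n * c) n ->
  N <= \sum_(j < n) (n - minn (a j - n * c) n) ->
  \sum_(j < n) ((a j - n * c.+1) + (n * c - a j)) + N + ~~ (n %| \sum_(j < n) a j) <=
  \sum_(j < n) ~~ (n %| a j) + \sum_(j < n) gap g (a j)
  + ([exists j, a j <= g] && [exists j, g < a j]).
Proof.
move=> Nn Nup Ndown.
have gE : g = n * c + g %% n by rewrite mulnC -divn_eq.
have := ltn_pmod g n_gt0.
move: gE Nup Ndown; move: c => c; move: (g %% n) => r gE Nup Ndown rn.
(* By [sum_gap_row], [cost x] is the total gap of the row of [x]. The slack [e x] by which [gap g x]
   exceeds it, the corrections [t] and the possible extra 1 have to pay for [N] and for the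
   correction of the sum. *)
pose cost x := (x - n * c.+1) + (n * c - x).
pose t x : nat := ~~ (n %| x).
pose e x := gap g x - cost x.
have costE x : cost x + e x = gap g x.
  by rewrite /e /cost /gap mulnS; lia.
suff : N + ~~ (n %| \sum_(j < n) a j) <= \sum_(j < n) (t (a j) + e (a j))
    + ([exists j, a j <= g] && [exists j, g < a j]).
  have -> : \sum_(j < n) gap g (a j) = \sum_(j < n) cost (a j) + \sum_(j < n) e (a j).
    by rewrite -big_split; apply: eq_bigr => j _ /=; rewrite costE.
  rewrite -[X in X + _ + _ <= _]/(\sum_(j < n) cost (a j)).
  rewrite -[X in _ <= X + _ + _]/(\sum_(j < n) t (a j)).
  rewrite big_split/=; lia.
(* With [g = n * c + r], the slack is constant above and below the block from [n * c] to
   [n * c + n]; inside it is all of [gap g], up to the pair [{g, g + 1}]. *)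
have e1 x : n * c + n <= x -> e x = n - 1 - r.
  by rewrite /e /cost /gap mulnS; lia.
have e2 x : x < n * c -> e x = r.
  by rewrite /e /cost /gap mulnS; lia.
have e3 x : n * c <= x < n * c + n -> e x = (x - g.+1) + (g - x).
  by rewrite /e /cost /gap mulnS; lia.
have t1 x : n * c < x < n * c + n -> t x = 1.
  by move=> /ndvd_between; rewrite /t => ->.
have d1 : ~~ (n %| \sum_(j < n) a j) <= \sum_(j < n) t (a j) := ndvd_sum a.
have bs : \sum_(j < n) (t (a j) + e (a j)) =
    \sum_(j < n) t (a j) + \sum_(j < n) e (a j) by rewrite big_split.
clearbody t e.
have sumn1 : \sum_(j < n) 1 = n by rewrite sum_nat_const card_ord muln1.
case: (boolP [exists j, a j <= g]) => [ex_low|/existsPn no_low]; last first.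
  have hi j : g < a j by have := no_low j; lia.
  rewrite addn0.
  have d2 := ndvd_sum_neq a g.+1; have nE := sum_eq_neq a g.+1.
  (* Here all entries exceed [g]. For [r = n - 1] they are beyond the block and [N = 0]. For
     [r = n - 2] every row pays 1 and only rows equal to [g.+1] count towards [N]. For smaller [r],
     rows other than [g.+1] pay 2. In the last two cases such rows cover the correction of the sum,
     by [ndvd_sum_neq]. *)
  have [rE|[rE|rE]] : r = n - 1 \/ r = n - 2 /\ 2 <= n \/ r + 2 < n by lia.
  - have : N <= 0.
      apply: (leq_trans Ndown); rewrite big1// => j _.
      by have := hi j; lia.
    by rewrite bs; lia.
  - have h1 : \sum_(j < n) 1 <= \sum_(j < n) (t (a j) + e (a j)).
      apply: leq_sum => j _.
      by have := hi j; have := e1 (a j); have := e3 (a j); have := t1 (a j); lia.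
    have h2 : N <= \sum_(j < n) (a j == g.+1).
      apply: (leq_trans Ndown); apply: leq_sum => j _.
      by have := hi j; lia.
    by lia.
  - have : \sum_(j < n) (1 + (a j != g.+1)) <= \sum_(j < n) (t (a j) + e (a j)).
      apply: leq_sum => j _.
      by have := hi j; have := e1 (a j); have := e3 (a j); have := t1 (a j); lia.
    have -> : \sum_(j < n) (1 + (a j != g.+1)) = n + \sum_(j < n) (a j != g.+1).
      by rewrite -[X in _ = X + _]sumn1 -big_split.
    by lia.
(* The mirror image of the previous case, with [g] in place of [g.+1]. *)
case: (boolP [exists j, g < a j]) => [ex_high|/existsPn no_high]; last first.
  have lo j : a j <= g by have := no_high j; lia.
  rewrite addn0.
  have d2 := ndvd_sum_neq a g; have nE := sum_eq_neq a g.
  have [rE|[rE|rE]] : r = 0 \/ r = 1 \/ 1 < r by lia.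
  - have : N <= 0.
      apply: (leq_trans Nup); rewrite big1// => j _.
      by have := lo j; lia.
    by rewrite bs; lia.
  - have h1 : \sum_(j < n) 1 <= \sum_(j < n) (t (a j) + e (a j)).
      apply: leq_sum => j _.
      by have := lo j; have := e2 (a j); have := e3 (a j); have := t1 (a j); lia.
    have h2 : N <= \sum_(j < n) (a j == g).
      apply: (leq_trans Nup); apply: leq_sum => j _.
      by have := lo j; lia.
    by lia.
  - have : \sum_(j < n) (1 + (a j != g)) <= \sum_(j < n) (t (a j) + e (a j)).
      apply: leq_sum => j _.
      by have := lo j; have := e2 (a j); have := e3 (a j); have := t1 (a j); lia.
    have -> : \sum_(j < n) (1 + (a j != g)) = n + \sum_(j < n) (a j != g).
      by rewrite -[X in _ = X + _]sumn1 -big_split.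
    by lia.
(* From here on the extra 1 is available, so a single row with slack [n - 1] already pays for
   [N <= n]. *)
have big_row j : n - 1 <= e (a j) ->
    n - 1 + ~~ (n %| \sum_(j < n) a j) <= \sum_(j < n) (t (a j) + e (a j)).
  move=> h; rewrite bs.
  suff : e (a j) <= \sum_(j < n) e (a j) by lia.
  by rewrite (bigD1 j)//= leq_addr.
(* At the two extreme values of [r], either some row has slack [n - 1], or each row pays for its own
   term in [Nup] or [Ndown]. For the other [r] every row pays at least 1, and [N <= n] suffices. *)
have [rE|[rE|rE]] : r = 0 \/ r = n - 1 \/ 0 < r < n - 1 by lia.
- case: (boolP [exists j, n * c + n <= a j]) => [/existsP[j hj]|/existsPn h].
    by have := big_row j; have := e1 (a j) hj; lia.
  suff : N <= \sum_(j < n) (t (a j) + e (a j)) by case: (~~ _); lia.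
  apply: (leq_trans Nup); apply: leq_sum => j _.
  by have := h j; have := e2 (a j); have := e3 (a j); have := t1 (a j); lia.
- case: (boolP [exists j, a j <= n * c]) => [/existsP[j hj]|/existsPn h].
    by have := big_row j; have := e2 (a j); have := e3 (a j); lia.
  suff : N <= \sum_(j < n) (t (a j) + e (a j)) by case: (~~ _); lia.
  apply: (leq_trans Ndown); apply: leq_sum => j _.
  by have := h j; have := e1 (a j); have := e3 (a j); have := t1 (a j); lia.
- suff : \sum_(j < n) 1 <= \sum_(j < n) (t (a j) + e (a j)) by case: (~~ _); lia.
  apply: leq_sum => j _.
  by have := e1 (a j); have := e2 (a j); have := e3 (a j); have := t1 (a j); lia.
Qed.

Theorem weight_sum M (a : 'I_n -> nat) g :
  weight M.+1 (\sum_(j < n) a j) <= \sum_(j < n) weight M (a j) + \sum_(j < n) gap g (a j)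
  + ([exists j, a j <= g] && [exists j, g < a j]).
Proof.
elim: M a g => [|M IH] a g.
  have -> : weight 1 (\sum_(j < n) a j) = ~~ (n %| \sum_(j < n) a j).
    by rewrite /= [X in X + _]big1.
  rewrite [X in X + _ + _]big1// add0n.
  case: (boolP (n %| _)) => [//|nd].
  case: (boolP ([exists j, a j <= g] && [exists j, g < a j])) => [_|h].
    by rewrite addn1.
  rewrite addn0.
  (* Without a crossing all [a j] are on one side of [g], and there the gap is positive as soon as
     [a j] differs from [g.+1], respectively [g]. *)
  have hv v : 0 < \sum_(j < n) (a j != v) by have := ndvd_sum_neq a v; rewrite nd.
  rewrite negb_and in h; case/orP: h => /existsPn h.
    apply: (leq_trans (hv g.+1)); apply: leq_sum => j _.
    by have := h j; rewrite /gap; lia.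
  apply: (leq_trans (hv g)); apply: leq_sum => j _.
  by have := h j; rewrite /gap; lia.
(* The extension of [a] by 0 to all naturals, so that partial sums can be indexed by naturals; [e]
   is the array. *)
pose b j := if insub j is Some i then a i else 0.
have bE (j : 'I_n) : b j = a j by rewrite /b valK.
pose e (j l : nat) := (\sum_(i < j) b i + b j + l) %/ n - (\sum_(i < j) b i + l) %/ n.
have row (f : nat -> nat) (j : 'I_n) : \sum_(l < n) f (e j l) = \sum_(l < n) f ((a j + l) %/ n).
  by rewrite /e sum_shift bE.
have col (l : 'I_n) : \sum_(j < n) e j l = (\sum_(j < n) a j + l) %/ n.
  rewrite /e col_telescope//; congr ((_ + _) %/ n).
  by apply: eq_bigr => j _.
(* Entries of the array are about [n] times smaller than the [a j], so the columns use the threshold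
   [g %/ n]. [up] marks the columns in which the induction hypothesis produces the extra 1. *)
pose c := g %/ n.
pose up (l : 'I_n) := [exists j : 'I_n, e j l <= c] && [exists j : 'I_n, c < e j l].
have step : weight M.+2 (\sum_(j < n) a j) <=
    \sum_(l < n) (\sum_(j < n) weight M (e j l) + \sum_(j < n) gap c (e j l) + up l)
    + ~~ (n %| \sum_(j < n) a j).
  rewrite [X in X <= _]/= -/(weight _ _) leq_add2r; apply: leq_sum => l _.
  by rewrite -col; exact: IH.
apply: (leq_trans step).
rewrite !big_split/= exchange_big [X in _ + X + _ + _]exchange_big/=.
rewrite (eq_bigr (fun j : 'I_n => \sum_(l < n) weight M ((a j + l) %/ n))); last first.
  by move=> j _; rewrite row.
rewrite [X in _ + X + _ + _](eq_bigr
  (fun j : 'I_n => (a j - n * c.+1) + (n * c - a j))); last first.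
  by move=> j _; rewrite row sum_gap_row.
have h1 : \sum_(l < n) up l <= n.
  rewrite -[X in _ <= X](_ : \sum_(l < n) 1 = n).
    by apply: leq_sum => l _; case: (up l).
  by rewrite sum_nat_const card_ord muln1.
(* A marked column has an entry above [c] and, for [h3], one not above [c]. Counting such entries by
   rows instead, with [sum_above_row], bounds the number of marked columns. *)
have h2 : \sum_(l < n) up l <= \sum_(j < n) minn (a j - n * c) n.
  rewrite [X in _ <= X](eq_bigr (fun j : 'I_n => \sum_(l < n) (c < e j l))); last first.
    by move=> j _; rewrite (row (fun x => c < x : nat)) sum_above_row.
  rewrite [X in _ <= X]exchange_big/=; apply: leq_sum => l _; rewrite /up.
  case: existsP => [_|//]; case: existsP => [[j hj]|//].
  by rewrite (bigD1 j)//= hj.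
have h3 : \sum_(l < n) up l <= \sum_(j < n) (n - minn (a j - n * c) n).
  rewrite [X in _ <= X](eq_bigr (fun j : 'I_n => \sum_(l < n) (e j l <= c))); last first.
    move=> j _; rewrite -sum_above_row -(row (fun x => c < x : nat)).
    apply/eqP; rewrite -(eqn_add2r (\sum_(l < n) (c < e j l))) subnK.
      rewrite -big_split/= (eq_bigr (fun=> 1)) ?sum_nat_const ?card_ord ?muln1//.
      by move=> l _; case: leqP.
    rewrite -[X in _ <= X](_ : \sum_(l < n) 1 = n).
      by apply: leq_sum => l _; case: (_ < _).
    by rewrite sum_nat_const card_ord muln1.
  rewrite [X in _ <= X]exchange_big/=; apply: leq_sum => l _; rewrite /up.
  case: existsP => [[j hj]|//]; case: existsP => [_|//].
  by rewrite (bigD1 j)//= hj.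
rewrite -!addnA leq_add2l !addnA; have := crossing_bound h1 h2 h3.
by rewrite [\sum_(j < n) gap g (a j)]big_split/= [X in _ <= X + _]addnA.
Qed.

End weight.

Local Open Scope classical_set_scope.
Local Open Scope ring_scope.

(** * Takagi-van der Waerden functions *)

Section dist_int.
Context {R : realType}.
Implicit Types (x y t : R).

Lemma dist_int_le t (z : int) : dist_int t <= `|t - z%:~R|.
Proof. by apply: ge_inf; [exists 0 => _ [w _ <-] | exists z]. Qed.

Lemma dist_int_ge t b : (forall z : int, b <= `|t - z%:~R|) -> b <= dist_int t.
Proof.
move=> h; apply: lb_le_inf; first by exists `|t - 0%:~R|, 0.
by move=> _ [z _ <-].
Qed.

Lemma dist_int_ge0 t : 0 <= dist_int t.
Proof. by apply: dist_int_ge => z. Qed.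

Lemma dist_int_between (m : int) t : m%:~R <= t <= m%:~R + 1 ->
  dist_int t = Num.min (t - m%:~R) (m%:~R + 1 - t).
Proof.
move=> /andP[h1 h2]; apply/eqP; rewrite eq_le; apply/andP; split.
  rewrite le_min; apply/andP; split.
    by rewrite (le_trans (dist_int_le t m))// ger0_norm// subr_ge0.
  rewrite (le_trans (dist_int_le t (m + 1)))// distrC rmorphD/= ger0_norm//.
  by rewrite subr_ge0.
apply: dist_int_ge => z; rewrite ge_min.
have [zm|mz] := lerP z m.
  apply/orP; left; rewrite (le_trans _ (ler_norm _))// lerB// ler_int//.
apply/orP; right; rewrite distrC (le_trans _ (ler_norm _))// lerB//.
by rewrite -[1]/(1%:~R) -rmorphD/= ler_int lezD1.
Qed.

Lemma dist_int_lip x y : dist_int x <= dist_int y + `|x - y|.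
Proof.
rewrite -lerBlDr; apply: dist_int_ge => z; rewrite lerBlDr.
rewrite (le_trans (dist_int_le x z))//.
have -> : x - z%:~R = (y - z%:~R) + (x - y) by ring.
exact: ler_normD.
Qed.

Lemma dist_int_half t : dist_int t <= 2^-1.
Proof.
have /andP[h1 h2] := floor_itv t.
rewrite (@dist_int_between (Num.floor t)).
  by rewrite ge_min; apply/orP; lra.
by rewrite h1/= -[1]/(1%:~R) -rmorphD/= ltW.
Qed.

Lemma dist_int_small t : 0 <= t <= 2^-1 -> dist_int t = t.
Proof.
move=> /andP[h1 h2]; rewrite (@dist_int_between 0) ?min_l ?subr0//=; lra.
Qed.

Lemma dist_int_natrB (k : nat) t : dist_int (k%:R - t) = dist_int t.
Proof.
suff h (u : R) : dist_int (k%:R - u) <= dist_int u.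
  apply/eqP; rewrite eq_le h/= -[X in dist_int X <= _](_ : k%:R - (k%:R - t) = t) ?h//.
  ring.
apply: dist_int_ge => z; rewrite (le_trans (dist_int_le _ (k%:Z - z)))//.
rewrite rmorphB/= -[X in X <= _]normrN (_ : - (_ - _) = u - z%:~R)//.
by rewrite -pmulrn; ring.
Qed.

End dist_int.

(** * Partial sums of omega: convergence, continuity, symmetry *)

Section omega.
Context {R : realType}.
Variable n : nat.
Hypothesis n_ge2 : (2 <= n)%N.
Implicit Types (x y t : R) (M K : nat).

Let n_gt0 : (0 < n)%N. Proof. exact: ltnW n_ge2. Qed.
Let nR_gt0 : 0 < n%:R :> R. Proof. by rewrite ltr0n. Qed.
Let nR_ge2 : 2 <= n%:R :> R. Proof. by rewrite (ler_nat _ 2). Qed.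
Let nX_gt0 k : 0 < n%:R ^+ k :> R. Proof. by rewrite exprn_gt0. Qed.
Let nV_le : n%:R^-1 <= 2^-1 :> R. Proof. by rewrite lef_pV2 ?posrE. Qed.

Definition tent t : R := Num.min (dist_int t) n%:R^-1.

Definition omega_term x k : R := tent (n%:R ^+ k * x) / n%:R ^+ k.

Definition omega_upto M x : R := \sum_(k < M) omega_term x k.

Lemma omegaE x : omega n x = limn (omega_upto ^~ x).
Proof.
rewrite (_ : omega_upto ^~ x = series (omega_term x))//.
by apply/funext => M; rewrite /series/= big_mkord.
Qed.

Lemma tent_ge0 t : 0 <= tent t.
Proof. by rewrite le_min dist_int_ge0 invr_ge0 ler0n. Qed.

Lemma omega_term_ge0 x k : 0 <= omega_term x k.
Proof. by rewrite divr_ge0 ?tent_ge0// ltW. Qed.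

(** The tent is at most 1/n, and 1/n <= 1 - 1/n because n >= 2. The bound is written as a difference
    so that it telescopes to the tail n^-M. *)
Lemma omega_term_le x k : omega_term x k <= n%:R ^- k - n%:R ^- k.+1.
Proof.
rewrite /omega_term exprS invfM.
have h : tent (n%:R ^+ k * x) <= n%:R^-1 by rewrite ge_min lexx orbT.
have i2 : n%:R^-1 <= 2^-1 :> R by rewrite lef_pV2 ?posrE.
have : 0 <= n%:R ^- k :> R by rewrite invr_ge0 ltW.
move: (n%:R^-1) (n%:R ^- k) h i2 => u v h i2 v0.
rewrite -[X in _ <= X - _]mul1r -mulrBl ler_wpM2r//; lra.
Qed.

Lemma omega_upto_homo x : nondecreasing_seq (omega_upto ^~ x).
Proof.
by apply/nondecreasing_seqP => M; rewrite /omega_upto big_ord_recr/= lerDl omega_term_ge0.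
Qed.

Lemma omega_upto_tail x M N : omega_upto (M + N) x <= omega_upto M x + n%:R ^- M.
Proof.
apply: (@le_trans _ _ (omega_upto M x + n%:R ^- M - n%:R ^- (M + N))); last first.
  by rewrite gerBl invr_ge0 ltW.
elim: N => [|N IH]; first by rewrite addn0 addrK.
rewrite addnS [X in X <= _]/omega_upto big_ord_recr/= -/(omega_upto (M + N) x).
have := omega_term_le x (M + N); lra.
Qed.

Lemma omega_upto_cvg x : cvgn (omega_upto ^~ x).
Proof.
apply: nondecreasing_is_cvgn; first exact: omega_upto_homo.
by exists (omega_upto 0 x + n%:R ^- 0) => _ [M _ <-]; exact: (omega_upto_tail x 0 M).
Qed.

Lemma omega_upto_le x M : omega_upto M x <= omega n x.
Proof.
by rewrite omegaE; apply: (@nondecreasing_cvgn_le _ (omega_upto ^~ x));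
  [exact: omega_upto_homo | exact: omega_upto_cvg].
Qed.

Lemma omega_le_upto x M : omega n x <= omega_upto M x + n%:R ^- M.
Proof.
rewrite omegaE; apply: limr_le; first exact: omega_upto_cvg.
near=> N; have -> : N = (M + (N - M))%N by rewrite subnKC//; near: N; exact: nbhs_infty_ge.
exact: omega_upto_tail.
Unshelve. all: by end_near. Qed.

Lemma tent_lip x y : tent x <= tent y + `|x - y|.
Proof.
have := dist_int_lip x y; have := normr_ge0 (x - y); rewrite /tent /Num.min.
by case: ifPn; rewrite -?leNgt => h1; case: ifPn; rewrite -?leNgt => h2; lra.
Qed.

(** Each term is 1-Lipschitz, as the dilation by n^k is undone by the division by n^k. *)
Lemma omega_upto_lip x y M : omega_upto M x <= omega_upto M y + M%:R * `|x - y|.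
Proof.
elim: M => [|M IH]; first by rewrite /omega_upto !big_ord0 mul0r addr0.
rewrite /omega_upto !big_ord_recr/= -!/(omega_upto _ _).
suff : omega_term x M <= omega_term y M + `|x - y|.
  by move: IH; rewrite -natr1 mulrDl mul1r; lra.
rewrite /omega_term ler_pdivrMr// mulrDl divfK ?gt_eqF//.
have := tent_lip (n%:R ^+ M * x) (n%:R ^+ M * y).
by rewrite -mulrBr normrM (gtr0_norm (nX_gt0 M)) [X in _ <= _ + X -> _]mulrC.
Qed.

Lemma omega_sub1 x : omega n (1 - x) = omega n x.
Proof.
rewrite !omegaE (_ : omega_upto ^~ (1 - x) = omega_upto ^~ x)//.
apply/funext => M; apply: eq_bigr => k _.
by rewrite /omega_term /tent mulrBr mulr1 -natrX dist_int_natrB.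
Qed.

Lemma omega_xstar x : omega n (xstar x) = omega n x.
Proof. by rewrite /xstar /Num.min; case: ifP => _ //; rewrite omega_sub1. Qed.

Lemma omega_upto0 M : omega_upto M 0 = 0.
Proof.
rewrite /omega_upto big1// => k _; rewrite /omega_term /tent mulr0.
have -> : dist_int (0 : R) = 0 by rewrite dist_int_small// lexx invr_ge0 ler0n.
by rewrite min_l ?mul0r// invr_ge0 ler0n.
Qed.

(** The cutoff [M] is left free: [omega_mass_small] derives it from the target error, [omega_asymp]
    takes it of order log(1/x). *)
Lemma omega_near0 x M : 0 <= x -> omega n x <= M%:R * x + n%:R ^- M.
Proof.
move=> x0; have := omega_le_upto x M; have := omega_upto_lip x 0 M.
by rewrite omega_upto0 subr0 ger0_norm//; lra.
Qed.

Lemma omega_near1 x M : x <= 1 -> omega n x <= M%:R * (1 - x) + n%:R ^- M.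
Proof. by move=> x1; rewrite -omega_sub1; apply: omega_near0; rewrite subr_ge0. Qed.

(** * Integer weights as values of omega *)

Definition scaled_tent i t : R := n%:R ^+ i * tent (t / n%:R ^+ i).

(** On each period of length n^(k+1) the graph is a trapezoid with slopes 1, 0 and -1 and height
    n^k; for n = 2 the plateau is a point. *)
Lemma scaled_tentE k (m : nat) t :
  m%:R * n%:R ^+ k.+1 <= t <= (m%:R + 1) * n%:R ^+ k.+1 ->
  scaled_tent k.+1 t =
  Num.min (Num.min (t - m%:R * n%:R ^+ k.+1) ((m%:R + 1) * n%:R ^+ k.+1 - t)) (n%:R ^+ k).
Proof.
move=> /andP[h1 h2]; rewrite /scaled_tent /tent (@dist_int_between _ m%:Z).
  rewrite !minr_pMr ?ltW// !mulrBr -!pmulrn; congr (Num.min (Num.min _ _) _).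
  - by rewrite mulrC divfK ?gt_eqF// mulrC.
  - by rewrite mulrC [X in _ - X]mulrC divfK ?gt_eqF.
  - by rewrite exprSr mulfK// gt_eqF.
by rewrite -!pmulrn ler_pdivlMr// ler_pdivrMr// h1.
Qed.

Lemma scaled_tentS i t : scaled_tent i.+1 t = n%:R * scaled_tent i (t / n%:R).
Proof. by rewrite /scaled_tent mulrA -exprS -[t / n%:R / _]mulrA -invfM -exprS. Qed.

(* The kinks of [scaled_tent k.+1] lie at integers. *)
Lemma scaled_tent_affine k (q : nat) t : 0 <= t <= 1 ->
  scaled_tent k.+1 (q%:R + t) =
  scaled_tent k.+1 q%:R + t * (scaled_tent k.+1 q.+1%:R - scaled_tent k.+1 q%:R).
Proof.
move=> /andP[t0 t1].
pose N := (n ^ k.+1)%N; pose H := (n ^ k)%N.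
have NE : n%:R ^+ k.+1 = N%:R :> R by rewrite natrX.
have HE : n%:R ^+ k = H%:R :> R by rewrite natrX.
have HN : (2 * H <= N)%N by rewrite /N expnS leq_mul2r n_ge2 orbT.
have N0 : (0 < N)%N by rewrite expn_gt0 n_gt0.
have qE := divn_eq q N; have rN := ltn_pmod q N0.
move: qE rN; move: (q %/ N)%N (q %% N)%N => m r qE rN.
have qR : q%:R = m%:R * N%:R + r%:R :> R by rewrite qE natrD natrM.
have HR : 2 * H%:R <= N%:R :> R by rewrite -natrM ler_nat.
have r1 : r%:R + 1 <= N%:R :> R by rewrite natr1 ler_nat.
have r0 : 0 <= r%:R :> R by [].
have E (s : R) : 0 <= s <= 1 -> scaled_tent k.+1 (q%:R + s) =
    Num.min (Num.min (r%:R + s) (N%:R - (r%:R + s))) H%:R.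
  move=> s01; rewrite (@scaled_tentE k m) ?NE ?HE; last by rewrite qR; lra.
  by congr (Num.min (Num.min _ _) _); rewrite qR; ring.
have E0 := E 0; rewrite addr0 lexx ler01 in E0.
have E1 := E 1; rewrite natr1 lexx ler01 in E1.
rewrite E ?t0// E0// E1//.
(* The unit interval starting at the residue [r] lies under the rising side, the falling side or the
   plateau. *)
have [h|[h|/andP[h1 h2]]] :
    (r + 1 <= H)%N \/ (N - H <= r)%N \/ (H <= r <= N - H - 1)%N by lia.
- have hR : r%:R + 1 <= H%:R :> R by rewrite natr1 ler_nat -addn1.
  have C (s : R) : 0 <= s <= 1 ->
    Num.min (Num.min (r%:R + s) (N%:R - (r%:R + s))) H%:R = r%:R + s.
    move=> s01; rewrite [Num.min (_ + _) _]min_l; last by lra.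
    by rewrite min_l//; lra.
  by rewrite !C; lra.
- have hR : N%:R <= r%:R + H%:R :> R by rewrite -natrD ler_nat; lia.
  have C (s : R) : 0 <= s <= 1 ->
    Num.min (Num.min (r%:R + s) (N%:R - (r%:R + s))) H%:R = N%:R - (r%:R + s).
    move=> s01; rewrite [Num.min (_ + _) _]min_r; last by lra.
    by rewrite min_l//; lra.
  by rewrite !C; lra.
- have hR1 : H%:R <= r%:R :> R by rewrite ler_nat.
  have hR2 : r%:R + 1 + H%:R <= N%:R :> R by rewrite natr1 -natrD ler_nat; lia.
  have C (s : R) : 0 <= s <= 1 ->
    Num.min (Num.min (r%:R + s) (N%:R - (r%:R + s))) H%:R = H%:R.
    by move=> s01; rewrite min_r// le_min; apply/andP; split; lra.
  by rewrite !C; lra.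
Qed.

(** The balanced parts of [s] are two consecutive integers with mean s/n, and the function is affine
    between them, so its mean over the parts is its value at s/n. *)
Lemma scaled_tent_sum k (s : nat) :
  scaled_tent k.+2 s%:R = \sum_(l < n) scaled_tent k.+1 ((s + l) %/ n)%:R.
Proof.
have sE := divn_eq s n; have rn := ltn_pmod s n_gt0.
set q := (s %/ n)%N in sE; set r := (s %% n)%N in sE rn.
have rR : (r%:R / n%:R) * n%:R = r%:R :> R by rewrite divfK// gt_eqF.
rewrite scaled_tentS.
have -> : s%:R / n%:R = q%:R + r%:R / n%:R :> R.
  by rewrite sE natrD natrM mulrDl mulfK// gt_eqF.
rewrite scaled_tent_affine; last first.
  by rewrite divr_ge0//= ler_pdivrMr// mul1r ler_nat ltnW.
set A := scaled_tent _ q%:R; set B := scaled_tent _ _.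
have E (l : 'I_n) : scaled_tent k.+1 ((s + l) %/ n)%:R =
    A + (((s + l) %/ n)%:R - q%:R) * (B - A).
  have [->|->] : ((s + l) %/ n = q \/ (s + l) %/ n = q.+1)%N.
    have := ltn_ord l; have := divn_eq (s + l) n.
    by have := ltn_pmod (s + l) n_gt0; nia.
  - by rewrite subrr mul0r addr0.
  - by rewrite -natr1 /B -natr1; ring.
rewrite (eq_bigr _ (fun l _ => E l)) big_split/= sumr_const card_ord.
rewrite -mulr_suml big_split/= sumr_const card_ord -natr_sum.
rewrite sum_ceil_divE// -(mulr_natl A) -(mulr_natl (- q%:R)) mulrDr mulrA [n%:R * (_ / _)]mulrC rR.
congr (_ + _ * _); rewrite {1}sE natrD natrM; ring.
Qed.

Lemma scaled_tent1 (s : nat) : scaled_tent 1 s%:R = (~~ (n %| s)%N)%:R.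
Proof.
have sE := divn_eq s n; have rn := ltn_pmod s n_gt0.
rewrite (_ : (n %| s)%N = (s %% n == 0)%N)//.
move: sE rn; move: (s %/ n)%N (s %% n)%N => q r sE rn.
have sR : s%:R = q%:R * n%:R + r%:R :> R by rewrite sE natrD natrM.
have rR : r%:R + 1 <= n%:R :> R by rewrite natr1 ler_nat.
have r0 : 0 <= r%:R :> R by [].
rewrite (@scaled_tentE 0 q) !expr1 ?expr0; last by rewrite sR; lra.
rewrite sR addrAC subrr add0r.
case: eqP => [->|/eqP rn0] /=.
  by rewrite min_l ?min_l//; lra.
have r1 : 1 <= r%:R :> R by rewrite ler1n lt0n.
by rewrite min_r// le_min r1/=; lra.
Qed.

(** Both sides obey the same recursion: [scaled_tent1] is the correction in [weight], and
    [scaled_tent_sum] is the sum over balanced parts. *)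
Lemma weight_scaled_tent M (s : nat) :
  (weight n M s)%:R = \sum_(i < M) scaled_tent i.+1 s%:R.
Proof.
elim: M s => [|M IH] s; first by rewrite big_ord0.
rewrite /= natrD natr_sum big_ord_recl/= scaled_tent1 addrC; congr (_ + _).
under eq_bigr do rewrite IH.
rewrite exchange_big/=; apply: eq_bigr => i _.
by rewrite -scaled_tent_sum.
Qed.

(** The term of index i of omega at s/n^M, multiplied by n^M, is [scaled_tent (M - i)] at [s]; hence
    the reversal of the sum. *)
Lemma weight_omega M (s : nat) :
  (weight n M s)%:R = n%:R ^+ M * omega_upto M (s%:R / n%:R ^+ M) :> R.
Proof.
rewrite weight_scaled_tent (reindex_inj rev_ord_inj)/= /omega_upto mulr_sumr.
apply: eq_bigr => i _; rewrite /omega_term /scaled_tent subnSK//.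
have iM : (i <= M)%N by rewrite ltnW.
have E : n%:R ^+ M = n%:R ^+ (M - i) * n%:R ^+ i :> R by rewrite -exprD subnK.
rewrite E; have := gt_eqF (nX_gt0 i); have := gt_eqF (nX_gt0 (M - i)).
move: (n%:R ^+ (M - i)) (n%:R ^+ i) => u v /negbT u0 /negbT v0.
have -> : v * (s%:R / (u * v)) = s%:R / u by field; rewrite v0 u0.
by rewrite -mulrA [v * _]mulrC divfK.
Qed.

(** The distance from [a j] to [mu] exceeds the gap by at least [mu - g] if [a j] is on the lower
    side, by [g + 1 - mu] if it is on the upper side. One entry of each kind gives the extra 1. *)
Lemma gap_le_dist (a : 'I_n -> nat) (mu : R) (g := Num.truncn mu) : 0 <= mu ->
  (\sum_(j < n) gap g (a j)
    + ([exists j, (a j <= g)%N] && [exists j, (g < a j)%N]))%:R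
  <= \sum_(j < n) `|(a j)%:R - mu|.
Proof.
move=> mu0; have /andP[g1 g2] := truncn_itv mu0; rewrite -/g in g1 g2.
rewrite -natr1 in g2.
pose e (j : 'I_n) := if (a j <= g)%N then mu - g%:R else g%:R + 1 - mu.
have e0 j : 0 <= e j by rewrite /e; case: ifP; lra.
have E j : (gap g (a j))%:R + e j <= `|(a j)%:R - mu|.
  rewrite /gap /e; case: leqP => h.
    have -> : (a j - g.+1 = 0)%N by lia.
    rewrite add0n natrB// distrC (le_trans _ (ler_norm _))//; lra.
  have -> : (g - a j = 0)%N by lia.
  by rewrite addn0 natrB// -natr1 (le_trans _ (ler_norm _))//; lra.
rewrite natrD natr_sum; apply: le_trans (ler_sum _ (fun j _ => E j)).
rewrite big_split/= lerD2l.
case: existsP => [[j1 h1]|_]; last by rewrite sumr_ge0.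
case: existsP => [[j2 h2]|_]; last by rewrite sumr_ge0.
have j12 : j2 != j1 by apply: contraTneq h2 => ->; rewrite -leqNgt.
rewrite (bigD1 j1)//= (bigD1 j2)//= {1}/e h1 {1}/e leqNgt h2/=.
have : 0 <= \sum_(i < n | (i != j1) && (i != j2)) e i by rewrite sumr_ge0.
lra.
Qed.

(** Since (M+1)^2 <= 4 n^M, a positive [a] would satisfy a (M+1) <= 4 C for every [M]. This disposes
    of rounding errors that are linear in [M] before the division by n^M. *)
Lemma le0_of_small (a C : R) : 0 <= C ->
  (forall M, a <= C * M.+1%:R / n%:R ^+ M) -> a <= 0.
Proof.
move=> C0 h; rewrite leNgt; apply/negP => a0.
have sq M : (M.+1 ^ 2 <= 4 * n ^ M)%N.
  apply: (@leq_trans (4 * 2 ^ M)%N); last first.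
    by rewrite leq_mul2l; case: M => //= M; rewrite leq_exp2r.
  elim: M => [//|[//|[//|M]] IH]; rewrite [(2 ^ M.+3)%N]expnS.
  by move: IH; move: (2 ^ M.+2)%N => u; nia.
pose M := Num.truncn (4 * C / a).
have hM := h M.
have : a * M.+1%:R <= 4 * C.
  rewrite ler_pdivlMr// in hM.
  have := sq M; rewrite -(ler_nat R) natrM !natrX => s.
  have M0 : 0 < M.+1%:R :> R by rewrite ltr0Sn.
  rewrite -(ler_pM2r M0); nra.
have : 4 * C / a < M.+1%:R by rewrite truncnS_gt.
by rewrite ltr_pdivrMr// => h3 h2; lra.
Qed.

Theorem omega_mean (x : 'I_n -> R) (xm := (\sum_(j < n) x j) / n%:R) :
  (forall j, 0 <= x j) ->
  n%:R * omega n xm <= \sum_(j < n) omega n (x j) + \sum_(j < n) `|x j - xm|.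
Proof.
move=> x0.
have xm0 : 0 <= xm by rewrite divr_ge0// sumr_ge0.
have xmE : xm * n%:R = \sum_(j < n) x j by rewrite divfK// gt_eqF.
clearbody xm.
(* At scale n^M, replacing reals by integers costs n in [B1], n M in [B2] and n (M+1) in [B3], and
   truncating omega costs 1 in [T3]: altogether 2 n (M+1) + 1. *)
rewrite -subr_le0; apply: (@le0_of_small _ (2 * n%:R + 1)) => [|M].
  by rewrite addr_ge0// mulr_ge0.
pose P : R := n%:R ^+ M.
have P0 : 0 < P := nX_gt0 M.
pose a j := Num.truncn (P * x j).
have aI j : (a j)%:R <= P * x j < (a j)%:R + 1.
  by rewrite natr1 truncn_itv// mulr_ge0// ltW.
have mu0 : 0 <= P * xm by rewrite mulr_ge0// ltW.
have key := weight_sum n_gt0 M a (Num.truncn (P * xm)).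
rewrite -(ler_nat R) -addnA natrD in key.
have {key} := le_trans key (lerD (lexx _) (gap_le_dist a mu0)).
have B1 : \sum_(j < n) `|(a j)%:R - P * xm| <= P * \sum_(j < n) `|x j - xm| + n%:R.
  have -> : n%:R = \sum_(j < n) 1 :> R by rewrite sumr_const card_ord.
  rewrite mulr_sumr -big_split/=; apply: ler_sum => j _.
  have -> : P * `|x j - xm| = `|P * x j - P * xm|.
    by rewrite -mulrBr normrM gtr0_norm.
  have -> : (a j)%:R - P * xm = (P * x j - P * xm) + ((a j)%:R - P * x j) by ring.
  rewrite (le_trans (ler_normD _ _))// lerD2l ler_norml; have := aI j; lra.
have B2 : (\sum_(j < n) weight n M (a j))%:R <=
    P * \sum_(j < n) omega_upto M (x j) + n%:R * M%:R.
  have -> : n%:R * M%:R = \sum_(j < n) M%:R :> R.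
    by rewrite sumr_const card_ord mulr_natl.
  rewrite natr_sum mulr_sumr -big_split/=; apply: ler_sum => j _.
  rewrite weight_omega -/P.
  apply: (le_trans (ler_wpM2l (ltW P0) (omega_upto_lip _ (x j) M))).
  rewrite mulrDr lerD2l mulrCA ler_piMr//.
  rewrite -[X in X * _](gtr0_norm P0) -normrM mulrBr [P * (_ / _)]mulrC divfK ?gt_eqF//.
  by rewrite ler_norml; have := aI j; lra.
have B3 : n%:R * P * omega_upto M.+1 xm <=
    (weight n M.+1 (\sum_(j < n) a j))%:R + n%:R * M.+1%:R.
  rewrite weight_omega exprS -/P.
  have nP0 : 0 < n%:R * P by rewrite mulr_gt0.
  apply: (le_trans (ler_wpM2l (ltW nP0)
    (omega_upto_lip _ ((\sum_(j < n) a j)%:R / (n%:R * P)) M.+1))).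
  rewrite mulrDr lerD2l mulrCA mulrC ler_wpM2r//.
  rewrite -[X in X * _](gtr0_norm nP0) -normrM mulrBr [_ * P * (_ / _)]mulrC divfK ?gt_eqF//.
  have -> : n%:R * P * xm = \sum_(j < n) P * x j.
    by rewrite -mulr_sumr -xmE; ring.
  rewrite natr_sum -sumrB (le_trans (ler_norm_sum _ _ _))//.
  have -> : n%:R = \sum_(j < n) 1 :> R by rewrite sumr_const card_ord.
  by apply: ler_sum => j _; rewrite ler_norml; have := aI j; lra.
move=> key.
have T1 : omega n xm <= omega_upto M.+1 xm + (n%:R * P)^-1.
  by rewrite -exprS; exact: omega_le_upto.
have T2 : \sum_(j < n) omega_upto M (x j) <= \sum_(j < n) omega n (x j).
  by apply: ler_sum => j _; exact: omega_upto_le.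
rewrite ler_pdivlMr// -/P.
have T3 : n%:R * P * omega n xm <= n%:R * P * omega_upto M.+1 xm + 1.
  have nP0 : 0 < n%:R * P by rewrite mulr_gt0.
  apply: (le_trans (ler_wpM2l (ltW nP0) T1)).
  by rewrite mulrDr mulfV// gt_eqF.
have T4 := ler_wpM2l (ltW P0) T2.
have M0 : 0 <= M%:R :> R by [].
move: B3; rewrite -[M.+1%:R]natr1 => B3.
lra.
Qed.

(** * The size of omega near 0 *)

Lemma tent_small t : 0 <= t <= n%:R^-1 -> tent t = t.
Proof.
move=> /andP[t0 t1]; rewrite /tent dist_int_small ?min_l//.
by rewrite t0 (le_trans t1).
Qed.

Lemma omega_upto_small y K : 0 <= y -> y * n%:R ^+ K <= 1 ->
  omega_upto K y = K%:R * y.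
Proof.
move=> y0 yK; rewrite /omega_upto (eq_bigr (fun=> y)).
  by rewrite sumr_const card_ord mulr_natl.
move=> i _; rewrite /omega_term tent_small; first by rewrite mulrC mulKf// gt_eqF.
rewrite mulr_ge0 ?(ltW (nX_gt0 _))//= -[X in _ <= X]mul1r ler_pdivlMr// mulrAC -exprSr mulrC.
by rewrite (le_trans _ yK)// ler_wpM2l// ler_eXn2l// ltr1n.
Qed.

Lemma omega_pow k : omega n (n%:R ^- k) = k%:R * n%:R ^- k :> R.
Proof.
have y0 : 0 <= n%:R ^- k :> R by rewrite invr_ge0 ltW.
have E : omega_upto k (n%:R ^- k) = k%:R * n%:R ^- k :> R.
  by rewrite omega_upto_small// mulVf// gt_eqF.
(* From index [k] on, the tent is evaluated at integers and the terms vanish; the tail bound then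
   tends to 0. *)
apply/eqP; rewrite eq_le -{2}E omega_upto_le// andbT -subr_le0.
apply: (@le0_of_small _ 1) => // M.
have := omega_le_upto (n%:R ^- k : R) (k + M).
have -> : omega_upto (k + M) (n%:R ^- k) = k%:R * n%:R ^- k :> R.
  rewrite -E; elim: M => [|M IH]; first by rewrite addn0.
  rewrite addnS /omega_upto big_ord_recr/= -/(omega_upto _ _) IH.
  rewrite /omega_term exprD [_ * n%:R ^+ M]mulrC mulfK ?gt_eqF//.
  have -> : tent (n%:R ^+ M) = 0 :> R.
    apply/eqP; rewrite eq_le tent_ge0 andbT /tent ge_min.
    have := dist_int_le (n%:R ^+ M : R) (n ^ M)%N%:Z.
    by rewrite -pmulrn natrX subrr normr0 => ->.
  by rewrite mul0r addr0.
move=> h; rewrite lerBlDl (le_trans h)// lerD2l mul1r exprD invfM.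
have n1 m : n%:R ^- m <= 1 :> R by rewrite invf_le1// exprn_ege1// ler1n.
by apply: ler_pM; rewrite ?invr_ge0 ?(ltW (nX_gt0 _))// (le_trans (n1 _))// ler1n.
Qed.

(** [K] is the integer part of the base n logarithm of 1/y; it exists because [y <= 2^-1] excludes 0
    as the first exponent exceeding 1. *)
Lemma log_scale y : 0 < y -> y <= 2^-1 ->
  exists K, y * n%:R ^+ K <= 1 /\ 1 < y * n%:R ^+ K.+1.
Proof.
move=> y0 y1.
have ex : exists M, 1 < y * n%:R ^+ M.
  exists (Num.truncn y^-1).+1; rewrite mulrC -ltr_pdivrMr// mul1r.
  rewrite (lt_trans (truncnS_gt _))// -natrX ltr_nat; exact: ltn_expl.
case: (ex_minnP ex) => -[|K] h1 h2; first by move: h1; rewrite expr0; lra.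
exists K; split=> //; rewrite leNgt; apply/negP => /h2; by rewrite ltnn.
Qed.

Lemma omega_asymp : exists c C : R, [/\ 0 < c, c <= C &
  forall x : R, 0 < x -> x < 1 ->
    c * (xstar x * ln (xstar x)^-1) <= omega n (xstar x) /\
    omega n (xstar x) <= C * (xstar x * ln (xstar x)^-1)].
Proof.
pose lam : R := ln n%:R; pose el : R := ln 2.
have el0 : 0 < el by apply: ln_gt0; rewrite ltr1n.
have lamel : el <= lam by rewrite ler_ln ?posrE.
have lam0 : 0 < lam := lt_le_trans el0 lamel.
(* With [K] from [log_scale] and L = log(1/y), one has K lam <= L <= (K+1) lam and el <= L. The
   lower constant comes from L <= 2 K lam and omega(y) >= K y when K >= 1, its factor n from the
   case K = 0. The upper one comes from omega(y) <= (K+2) y and (K+2) el <= 3 L. *)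
exists ((2 * n%:R * lam)^-1), (3 / el); split.
- by rewrite invr_gt0 !mulr_gt0.
- rewrite (@le_trans _ _ el^-1)//.
    rewrite lef_pV2 ?posrE ?mulr_gt0//.
    apply: (le_trans lamel); rewrite ler_peMl ?(ltW lam0)// -natrM ler1n muln_gt0//.
  rewrite ler_peMl ?invr_ge0 ?(ltW el0)//; lra.
move=> x x0 x1; set y := xstar x.
have y0 : 0 < y by rewrite lt_min x0 subr_gt0.
have y2 : y <= 2^-1.
  by rewrite /y /xstar ge_min; case: (lerP x 2^-1) => //= h; lra.
have [K [K1 K2]] := log_scale y0 y2.
set L := ln y^-1.
have lnX k : ln (n%:R ^+ k) = k%:R * lam by rewrite lnXn// mulr_natl.
have L1 : K%:R * lam <= L.
  by rewrite -lnX ler_ln ?posrE ?invr_gt0// -[y^-1]mul1r ler_pdivlMr// mulrC.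
have L2 : L <= (K%:R + 1) * lam.
  rewrite natr1 -lnX ler_ln ?posrE ?invr_gt0// -[y^-1]mul1r ler_pdivrMr// mulrC.
  exact: ltW.
have L3 : el <= L.
  by rewrite ler_ln ?posrE ?invr_gt0// -[2]invrK lef_pV2 ?posrE ?invr_gt0.
have K0 : 0 <= K%:R :> R by [].
split.
- rewrite mulrC ler_pdivrMr ?mulr_gt0//.
  (* For K = 0 the bound K y is void; but then y > 1/n, so the first term of omega is already
     1/n. *)
  case: K K1 K2 L1 L2 K0 => [|K] K1 K2 L1 L2 K0.
    have h : n%:R^-1 <= omega n y.
      apply: le_trans (omega_upto_le y 1).
      rewrite /omega_upto big_ord1 /omega_term expr0 mul1r divr1 /tent le_min lexx andbT.
      rewrite dist_int_small ?(ltW y0)//.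
      by rewrite -[X in X <= _]mul1r ler_pdivrMr// ltW.
    have h2 : 1 <= omega n y * n%:R by rewrite -ler_pdivrMr// mul1r.
    have : y * L <= 1 * lam by apply: ler_pM; lra.
    have : lam <= (omega n y * n%:R) * lam by rewrite ler_peMl// ltW.
    lra.
  have h : K.+1%:R * y <= omega n y.
    by rewrite -(omega_upto_small (ltW y0) K1); exact: omega_upto_le.
  have k1 : 1 <= K.+1%:R :> R by rewrite ler1n.
  have : L <= 2 * K.+1%:R * lam.
    apply: (le_trans L2); rewrite ler_wpM2r ?(ltW lam0)//; lra.
  move/(ler_wpM2l (ltW y0)) => h1.
  have h2 : 0 <= omega n y - K.+1%:R * y by rewrite subr_ge0.
  have h3 : 0 <= (omega n y - K.+1%:R * y) * (2 * n%:R * lam).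
    by rewrite mulr_ge0// !mulr_ge0// ltW.
  have h4 : 0 <= (2 * K.+1%:R * lam * y) * (n%:R - 1).
    by rewrite mulr_ge0 ?mulr_ge0 ?(ltW lam0) ?(ltW y0)// subr_ge0 ler1n.
  lra.
- rewrite mulrAC ler_pdivlMr//.
  have h : omega n y <= (K%:R + 2) * y.
    have := omega_near0 K.+1 (ltW y0).
    have : n%:R ^- K.+1 <= y.
      by rewrite -[X in X <= _]mul1r ler_pdivrMr// ltW.
    rewrite -natr1; lra.
  have h1 := ler_wpM2r (ltW el0) h.
  have h2 : K%:R * el <= K%:R * lam by rewrite ler_wpM2l.
  have h3 : 0 <= y * (3 * L - (K%:R + 2) * el) by rewrite mulr_ge0 ?(ltW y0)//; lra.
  lra.
Qed.

End omega.

Lemma omega2_takagi (R : realType) (x : R) : omega 2 x = takagi x.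
Proof.
rewrite /omega /takagi; congr (limn (series _)); apply/funext => k.
by rewrite min_l ?dist_int_half// mulrC.
Qed.

(** * Densities on n-adic intervals *)

Section atoms.
Context {R : realType}.
Variable n : nat.
Hypothesis n_gt0 : (0 < n)%N.
Notation mu := (@leb R).
Implicit Types (m k : nat) (x : R).

Let nX_gt0 m : 0 < n%:R ^+ m :> R. Proof. by rewrite exprn_gt0// ltr0n. Qed.

Definition atom m k : set R := `[k%:R / n%:R ^+ m, k.+1%:R / n%:R ^+ m[%classic.

(** For [x >= 0], the index of the interval of level [m] that contains [x]. *)
Definition digits m x := Num.truncn (n%:R ^+ m * x).

Lemma atomP m k x : atom m k x <-> k%:R <= n%:R ^+ m * x < k.+1%:R.
Proof.
by rewrite /atom /= in_itv/= ler_pdivrMr// ltr_pdivlMr// mulrC.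
Qed.

Lemma unit_itvP x : unit_itv x <-> 0 <= x < 1.
Proof. by rewrite /unit_itv /= in_itv. Qed.

Lemma atom_ge0 m k x : atom m k x -> 0 <= x.
Proof. by move=> /atomP/andP[h _]; rewrite -(pmulr_rge0 _ (nX_gt0 m)) (le_trans _ h). Qed.

Lemma atom_digits m k x : atom m k x -> digits m x = k.
Proof. by move=> /atomP; exact: truncn_def. Qed.

Lemma digits_atom m x : 0 <= x -> atom m (digits m x) x.
Proof. by move=> x0; apply/atomP/truncn_itv; rewrite mulr_ge0// ltW. Qed.

Lemma digits_lt m x : unit_itv x -> (digits m x < n ^ m)%N.
Proof.
move=> /unit_itvP/andP[x0 x1]; rewrite truncn_lt_nat ?mulr_ge0 ?(ltW (nX_gt0 _))//.
by rewrite natrX gtr_pMr.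
Qed.

Lemma atom_sub m k : (k < n ^ m)%N -> atom m k `<=` unit_itv.
Proof.
move=> km x h; apply/unit_itvP; rewrite (atom_ge0 h)/=.
move/atomP : h => /andP[_ h]; rewrite -(ltr_pM2l (nX_gt0 m)) mulr1.
by rewrite (lt_le_trans h)// -natrX ler_nat.
Qed.

Lemma trivIset_atom m (I : set nat) : trivIset I (atom m).
Proof.
by move=> i j _ _ [x [/atom_digits <- /atom_digits <-]].
Qed.

Lemma unit_itv_atoms m :
  unit_itv = \big[setU/set0]_(k <- index_iota 0 (n ^ m)) atom m k.
Proof.
rewrite -bigcup_seq; apply/seteqP; split => [x Dx|x [k /=]].
  exists (digits m x); first by rewrite /= mem_index_iota digits_lt.
  by apply: digits_atom; move/unit_itvP : Dx => /andP[].
by rewrite mem_index_iota => /andP[_ km]; exact: atom_sub.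
Qed.

Lemma atomS m i : atom m.+1 i `<=` atom m (i %/ n)%N.
Proof.
move=> x /atomP/andP[h1 h2]; apply/atomP.
have n0 : 0 < n%:R :> R by rewrite ltr0n.
rewrite exprS -mulrA mulrC in h1 h2.
apply/andP; split.
  rewrite -(ler_pM2r n0) (le_trans _ h1)// -natrM ler_nat; exact: leq_trunc_div.
rewrite -(ltr_pM2r n0) (lt_le_trans h2)// -natrM ler_nat ltn_ceil//.
Qed.

Lemma atom_split m k :
  atom m k = \big[setU/set0]_(j < n) atom m.+1 (k * n + j)%N.
Proof.
rewrite -(big_mkord xpredT (fun j => atom m.+1 (k * n + j)%N)).
rewrite -bigcup_seq; apply/seteqP; split => [x Dx|x [j /=]].
  have x0 := atom_ge0 Dx.
  have Ax := digits_atom m.+1 x0.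
  have := atom_digits Dx; have := atom_digits (atomS Ax) => -> kE.
  exists (digits m.+1 x %% n)%N; first by rewrite /= mem_index_iota ltn_pmod.
  by rewrite -kE -divn_eq.
rewrite mem_index_iota => /andP[_ jn] /atomS.
by rewrite divnMDl// divn_small// addn0.
Qed.

Lemma measurable_leb_itv (i : interval R) : measurable ([set` i] : set (lebesgueType R)).
Proof. by apply: sub_caratheodory; exact: measurable_itv. Qed.

Lemma leb_itvco (a b : R) : a <= b -> mu `[a, b[%classic = (b - a)%:E.
Proof.
move=> ab; rewrite -[leb _]/(lebesgue_measure _) lebesgue_measure_itv/= lte_fin.
by case: ltP => [//|ba]; rewrite (@le_anti _ _ a b) ?subrr// ab.
Qed.

Lemma measurable_unit_itv : measurable (unit_itv : set (lebesgueType R)).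
Proof. exact: measurable_leb_itv. Qed.

Lemma measurable_atom m k : measurable (atom m k : set (lebesgueType R)).
Proof. exact: measurable_leb_itv. Qed.

Lemma leb_atom m k : mu (atom m k) = (n%:R ^- m)%:E.
Proof.
rewrite leb_itvco -?mulrBl -?natr1 1?addrAC ?subrr ?add0r ?mul1r//.
by rewrite ler_wpM2r ?invr_ge0 ?(ltW (nX_gt0 _))// lerDl.
Qed.

Lemma leb_unit_itv : mu unit_itv = 1%:E.
Proof. by rewrite leb_itvco// subr0. Qed.

(** The sets that contain or miss each atom of level [m] entirely are closed under the sigma-algebra
    operations, and the atoms are among them. *)
Lemma adic_algebra_saturated m (B : set R) k x y : adic_algebra n m B ->
  (k < n ^ m)%N -> atom m k x -> atom m k y -> B x -> B y.
Proof.
move=> NB km kx ky.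
pose X : set (set R) := [set C | forall x y, atom m k x -> atom m k y -> C x -> C y].
suff : X B by apply.
apply: (smallest_sub _ _ NB).
  split=> [//|C XC z t kz kt [Dz nCz]|F XF z t kz kt [i _ Fz]].
    split; first exact: atom_sub kt.
    by move=> Ct; apply: nCz; exact: XC kt kz Ct.
  by exists i => //; exact: XF kz kt Fz.
move=> _ [j /= jm <-] z t kz kt jz.
by have := atom_digits jz; rewrite (atom_digits kz) => <-.
Qed.

Lemma adic_algebra_sub m (B : set R) : adic_algebra n m B -> B `<=` unit_itv.
Proof.
move=> NB; pose X : set (set R) := [set C | C `<=` unit_itv].
suff : X B by [].
apply: (smallest_sub _ _ NB); last by move=> _ [j /= jm <-]; exact: atom_sub.
split=> [//|C _ z []//|F FD z [i _ /FD]]; exact.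
Qed.

Lemma adic_algebra_measurable m :
  adic_algebra n m `<=` (measurable : set (set (lebesgueType R))).
Proof.
apply: smallest_sub; last by move=> _ [j /= jm <-]; exact: measurable_atom.
split=> [|C mC|F mF]; first exact: measurable0.
  by apply: measurableD => //; exact: measurable_unit_itv.
exact: bigcupT_measurable.
Qed.

Lemma adic_algebra_atoms m (P : set nat) :
  adic_algebra n m (\bigcup_(k in [set k | (k < n ^ m)%N /\ P k]) atom m k : set R).
Proof.
rewrite bigcup_mkcond; apply: sigma_algebra_bigcup => k.
case: ifPn => [|_]; last exact: sigma_algebra0.
by rewrite inE/= => -[km _]; apply: sub_sigma_algebra; exists k.
Qed.

(** * Conditional expectations of an indicator function *)

Section set_density.
Variable A : set (lebesgueType R).
Hypothesis mA : measurable A.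

Definition density m k : R := n%:R ^+ m * fine (mu (A `&` atom m k)).

Let mAI m k : measurable (A `&` atom m k : set (lebesgueType R)).
Proof. by apply: measurableI => //; exact: measurable_atom. Qed.

Lemma leb_atomI_le m k : (mu (A `&` atom m k) <= (n%:R ^- m)%:E)%E.
Proof.
rewrite -(leb_atom m k) le_measure ?inE//; exact: measurable_atom.
Qed.

Lemma leb_atomI_fin m k : mu (A `&` atom m k) \is a fin_num.
Proof.
by rewrite ge0_fin_numE// (le_lt_trans (leb_atomI_le m k))// ltry.
Qed.

Lemma densityK m k : mu (A `&` atom m k) = (density m k / n%:R ^+ m)%:E.
Proof. by rewrite /density mulrC mulKf ?gt_eqF// fineK// leb_atomI_fin. Qed.

Lemma density_ge0 m k : 0 <= density m k.
Proof. by rewrite mulr_ge0 ?(ltW (nX_gt0 _))// fine_ge0. Qed.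

Lemma density_le1 m k : density m k <= 1.
Proof.
have := leb_atomI_le m k; rewrite densityK lee_fin ler_pdivrMr//.
by rewrite mulVf// gt_eqF.
Qed.

Lemma density_mean m k :
  n%:R * density m k = \sum_(j < n) density m.+1 (k * n + j)%N.
Proof.
have : mu (A `&` atom m k) = (\sum_(j < n) mu (A `&` atom m.+1 (k * n + j)%N))%E.
  pose F j : set (lebesgueType R) := A `&` atom m.+1 (k * n + j)%N.
  rewrite -[RHS](@measure_bigsetU _ _ _ mu F).
  - congr (mu _); rewrite atom_split -(bigcup_mkord n F).
    by rewrite -(bigcup_mkord n (fun j => atom m.+1 (k * n + j)%N)) setI_bigcupr.
  - by move=> i; exact: mAI.
  - move=> i j _ _ [x [[_ ix] [_ jx]]].
    by have := atom_digits ix; rewrite (atom_digits jx) => /addnI.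
rewrite densityK; under eq_bigr do rewrite densityK.
rewrite sumEFin => -[].
rewrite -mulr_suml => /(congr1 (fun r => r * n%:R ^+ m.+1)).
rewrite divfK ?gt_eqF// => <-; rewrite exprSr mulrA divfK ?gt_eqF// mulrC//.
Qed.

Lemma measurable_step (c : nat -> R) m :
  preimage_set_system unit_itv (fun x => c (digits m x))
    (measurable : set (set (measurableTypeR R))) `<=` adic_algebra n m.
Proof.
move=> _ [B mB <-].
rewrite (_ : _ `&` _ = \bigcup_(k in [set k | (k < n ^ m)%N /\ B (c k)]) atom m k).
  exact: adic_algebra_atoms.
apply/seteqP; split => [x [Dx /= Bx]|x [k [/= km Bk] kx]].
  exists (digits m x) => /=; first by rewrite digits_lt.
  by apply: digits_atom => //; move/unit_itvP : Dx => /andP[].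
by split; [exact: atom_sub kx | rewrite /= (atom_digits kx)].
Qed.

Lemma algebra_measurable_fun m (g : R -> R) :
  preimage_set_system unit_itv g (measurable : set (set (measurableTypeR R)))
    `<=` adic_algebra n m ->
  measurable_fun (unit_itv : set (lebesgueType R)) (g : lebesgueType R -> R).
Proof.
by move=> h _ B mB; apply: (@adic_algebra_measurable m); apply: h; exists B.
Qed.

(** A set of the algebra is a union of atoms, and on each atom both integrals are the measure of its
    part in [A]. *)
Lemma cond_exp_step m :
  is_cond_exp mu unit_itv (adic_algebra n m) (\1_A : R -> R)
    (fun x => density m (digits m x)).
Proof.
split; first exact: measurable_step.
  apply: measurable_bounded_integrable.
  - exact: measurable_unit_itv.
  - by rewrite [X in (X < _)%E](leb_unit_itv) ltry.
  - by apply: (@algebra_measurable_fun m); exact: measurable_step.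
  - exists 1; split => // M M1 x _ /=.
    by rewrite ger0_norm ?density_ge0// (le_trans (density_le1 _ _))// ltW.
move=> B NB.
have mB := adic_algebra_measurable NB.
have BE : B = \big[setU/set0]_(k <- index_iota 0 (n ^ m)) (B `&` atom m k).
  rewrite -bigcup_seq -setI_bigcupr bigcup_seq -unit_itv_atoms//.
  rewrite setIidl//.
  exact: adic_algebra_sub NB.
have mBI k : measurable (B `&` atom m k : set (lebesgueType R)).
  by apply: measurableI => //; exact: measurable_atom.
have tI (I : set nat) : trivIset I (fun k => B `&` atom m k).
  move=> i j Ii Ij [x [[_ ix] [_ jx]]].
  by rewrite -(atom_digits ix) (atom_digits jx).
have mg : measurable_fun (B : set (lebesgueType R))
    ((fun x => (density m (digits m x))%:E) : lebesgueType R -> \bar R).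
  apply/measurable_EFinP.
  apply: (measurable_funS measurable_unit_itv (adic_algebra_sub NB)).
  by apply: (@algebra_measurable_fun m); exact: measurable_step.
have int_split (f : lebesgueType R -> \bar R) :
    measurable_fun (B : set (lebesgueType R)) f -> (forall x, 0 <= f x)%E ->
    (\int[mu]_(x in B) f x =
     \sum_(0 <= k < n ^ m) \int[mu]_(x in B `&` atom m k) f x)%E.
  move=> mf f0; rewrite [in LHS]BE; apply: ge0_integral_bigsetU.
  - exact: mBI.
  - exact: iota_uniq.
  - exact: tI.
  - by rewrite -BE.
  - by move=> x _; exact: f0.
have mi : measurable_fun (B : set (lebesgueType R))
    ((fun x => (\1_A x)%:E) : lebesgueType R -> \bar R).
  by apply/measurable_EFinP; exact: measurable_indic.
rewrite (int_split _ mg) => [|x]; last by rewrite lee_fin density_ge0.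
rewrite (int_split _ mi) => [|x]; last by rewrite lee_fin.
rewrite !big_seq; apply: eq_bigr => k; rewrite mem_index_iota => /andP[_ km].
rewrite (eq_integral (cst (density m k)%:E)); last first.
  by move=> x; rewrite inE => -[_ /atom_digits /= ->].
rewrite integral_cst// integral_indic//.
(* By saturation, an atom that meets [B] is contained in [B]. *)
have [[x [Bx kx]]|ne] := pselect (exists x, (B `&` atom m k) x).
  have -> : B `&` atom m k = atom m k.
    rewrite setIidr// => y ky; exact: adic_algebra_saturated NB km kx ky Bx.
  by rewrite [X in (_ * X)%E](leb_atom) [RHS]densityK.
have -> : B `&` atom m k = set0.
  by rewrite -subset0 => x Bx; apply: ne; exists x.
by rewrite setI0 !measure0 mule0.
Qed.

(** Every version is constant on atoms, being measurable for an algebra of unions of atoms. Hence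
    the equality holds at every point, whichever version was chosen. *)
Lemma adic_expE m k x : (k < n ^ m)%N -> atom m k x ->
  adic_exp n (\1_A : R -> R) m x = density m k.
Proof.
move=> km kx.
(* A version exists by [cond_exp_step], so the choice does not fall back on its default 0. *)
have := xgetPex (cst 0 : lebesgueType R -> R) (ex_intro _ _ (cond_exp_step m)).
rewrite -/(cond_exp _ _ _ _) -/(adic_exp n \1_A m).
move: (adic_exp n \1_A m) => g [h1 _ h3].
have gE y : atom m k y -> g y = g x.
  move=> ky.
  have NS : adic_algebra n m (unit_itv `&` g @^-1` [set g x]).
    by apply: h1; exists [set g x] => //; exact: measurable_set1.
  have [] // := adic_algebra_saturated NS km kx ky.
  by split=> //; exact: atom_sub kx.
have Nk : adic_algebra n m (atom m k).
  by apply: sub_sigma_algebra; exists k.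
have := h3 _ Nk.
rewrite (eq_integral (cst (g x)%:E)); last first.
  by move=> y; rewrite inE => /gE ->.
have mk : measurable (atom m k : set (lebesgueType R)) by exact: measurable_atom.
rewrite integral_cst// integral_indic//.
rewrite [X in (_ * X)%E](leb_atom) [RHS]densityK -EFinM => -[].
by apply: mulIf; rewrite invr_eq0 gt_eqF.
Qed.

Lemma measurable_adic_exp m :
  measurable_fun (unit_itv : set (lebesgueType R))
    (adic_exp n (\1_A : R -> R) m : lebesgueType R -> R).
Proof.
have := xgetPex (cst 0 : lebesgueType R -> R) (ex_intro _ _ (cond_exp_step m)).
rewrite -/(cond_exp _ _ _ _) -/(adic_exp n \1_A m) => -[h1 _ _].
exact: algebra_measurable_fun h1.
Qed.

(** For [0 < m] this is the L1 norm of d_m, by [integral_adic_diff]; [k %/ n] is the index of the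
    parent interval. *)
Definition diff_norm m : R :=
  \sum_(k < n ^ m) `|density m k - density m.-1 (k %/ n)%N| / n%:R ^+ m.

Lemma integral_adic_diff m : (0 < m)%N ->
  (\int[mu]_(x in unit_itv) (`|adic_diff n (\1_A : R -> R) m x|%:E) = (diff_norm m)%:E)%E.
Proof.
case: m => // m _.
have mf : measurable_fun (unit_itv : set (lebesgueType R))
    ((fun x => `|adic_diff n (\1_A : R -> R) m.+1 x|%:E) : lebesgueType R -> \bar R).
  apply/measurable_EFinP; apply: measurableT_comp => //.
  by apply: measurable_funB; exact: measurable_adic_exp.
rewrite (unit_itv_atoms m.+1); apply: (etrans (ge0_integral_bigsetU _ _ _ _ _ _)).
- by move=> k; exact: measurable_atom.
- exact: iota_uniq.
- exact: trivIset_atom.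
- by rewrite -unit_itv_atoms.
- by move=> x _; rewrite lee_fin.
rewrite /diff_norm -sumEFin -(big_mkord xpredT (fun k =>
  (`|density m.+1 k - density m (k %/ n)%N| / n%:R ^+ m.+1)%:E)).
rewrite big_seq [RHS]big_seq; apply: eq_bigr => k.
rewrite mem_index_iota => /andP[_ km].
rewrite (eq_integral (cst `|density m.+1 k - density m (k %/ n)%N|%:E)); last first.
  move=> x; rewrite inE => kx; rewrite /adic_diff /= (adic_expE km kx).
  rewrite (@adic_expE m (k %/ n)%N)//; first by rewrite ltn_divLR// -expnSr.
  exact: atomS.
rewrite integral_cst; last exact: measurable_atom.
by rewrite [X in (_ * X)%E](leb_atom).
Qed.

Lemma L1norm_S1 :
  L1norm (S1 n (\1_A : R -> R)) = (\sum_(1 <= m <oo) (diff_norm m)%:E)%E.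
Proof.
(* As [0.-1] is 0, the difference of index 0 vanishes, so the series may start at 0 for the exchange
   with the integral. *)
have d0 x : adic_diff n (\1_A : R -> R) 0 x = 0 by rewrite /adic_diff subrr.
have shift (u : nat -> \bar R) : (forall m, 0 <= u m)%E -> u 0%N = 0%E ->
    (\sum_(0 <= m <oo) u m = \sum_(1 <= m <oo) u m)%E.
  by move=> u0 u00; rewrite (nneseries_split 0 1)// big_nat1 u00 add0e.
rewrite /L1norm.
transitivity (\int[mu]_(x in unit_itv)
    \sum_(0 <= m <oo) `|adic_diff n (\1_A : R -> R) m x|%:E)%E.
  apply: eq_integral => x _; rewrite /S1 gee0_abs; last exact: nneseries_ge0.
  by rewrite shift// d0 normr0.
have mf m : measurable_fun (unit_itv : set (lebesgueType R))
    ((fun x => `|adic_diff n (\1_A : R -> R) m x|%:E) : lebesgueType R -> \bar R).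
  apply/measurable_EFinP; apply: measurableT_comp => //.
  by apply: measurable_funB; exact: measurable_adic_exp.
rewrite (integral_nneseries mu measurable_unit_itv mf); last first.
  by move=> m x _; rewrite lee_fin.
rewrite shift.
- rewrite (_ : (fun M => _) = (fun M => \sum_(1 <= m < M) (diff_norm m)%:E)%E)//.
  apply/funext => M; rewrite big_nat [RHS]big_nat.
  by apply: eq_bigr => m /andP[m0 _]; exact: integral_adic_diff.
- by move=> m; apply: integral_ge0.
- by apply: integral0_eq => x _; rewrite d0 normr0.
Qed.

End set_density.
End atoms.

Lemma sum_nat_mul (V : nmodType) (F : nat -> V) a n :
  \sum_(i < a * n) F i = \sum_(k < a) \sum_(j < n) F (k * n + j)%N.
Proof.
elim: a => [|a IH]; first by rewrite mul0n !big_ord0.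
by rewrite mulSnr big_split_ord/= IH big_ord_recr.
Qed.

(** A cover of [A] by half-open intervals with total length below |A| + e is cut after finitely many
    of them. What is lost of [A] lies in the tail, and what is added lies in the full cover [V],
    which exceeds [A] by at most [e]. *)
Lemma interval_cover (R : realType) (A : set (lebesgueType R)) (e : R) :
  measurable A -> (leb A < +oo)%E -> 0 < e ->
  exists N (a b : nat -> R),
    let U := \bigcup_(i in `I_N) (`]a i, b i]%classic : set (lebesgueType R)) in
    (leb (A `\` U) <= e%:E)%E /\ (leb (U `\` A) <= e%:E)%E.
Proof.
move=> mA Aoo e0.
have finA : leb A \is a fin_num by rewrite ge0_fin_numE.
have [F [mF AF] Fe] : exists2 F, @measurable_cover _ (ocitv_type R) A F &
    (\sum_(0 <= k <oo) wlength idfun (F k) < leb A + e%:E)%E.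
  by have [_/= [F AF <-] ?] := lb_ereal_inf_adherent e0 finA; exists F.
have mF' k : measurable (F k : set (lebesgueType R)).
  by apply: sub_caratheodory; apply: sub_sigma_algebra; exact: mF.
have Fab k : exists ab : R * R, F k = `]ab.1, ab.2]%classic.
  by have [ab _ <-] := mF k; exists ab.
have [ab abE] := choice Fab.
have wE k : leb (F k) = wlength idfun (F k).
  by rewrite -[leb _]/(mu_ext _ _) measurable_mu_extE.
have serE : (\sum_(0 <= k <oo) wlength idfun (F k) = \sum_(0 <= k <oo) leb (F k))%E.
  by apply: eq_eseriesr => k _; rewrite wE.
rewrite serE in Fe.
have ser_fin : (\sum_(0 <= k <oo) leb (F k) < +oo)%E.
  by rewrite (lt_trans Fe)// lte_add_pinfty// ltry.
pose V : set (lebesgueType R) := \bigcup_k F k.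
have mV : measurable V by exact: bigcupT_measurable.
have tail := nneseries_tail_cvg ser_fin (fun k _ => measure_ge0 leb (F k)).
have [N tailN] : exists N, (\sum_(N <= k <oo) leb (F k) < e%:E)%E.
  have e0' : (0%E < e%:E)%E by rewrite lte_fin.
  have := tail _ (open_ereal_lt' e0').
  by case=> N _ h; exists N; apply: h => /=.
exists N, (fun k => (ab k).1), (fun k => (ab k).2) => U.
have UE : U = \bigcup_(i in `I_N) F i by apply: eq_bigcupr => k _; rewrite abE.
have mU : measurable U by rewrite UE; apply: bigcup_measurable.
split.
  apply: (le_trans _ (ltW tailN)).
  apply: (le_trans _ (outer_measure_sigma_subadditive_tail (mu_ext (@wlength R idfun)) N F)).
  apply: le_outer_measure => x [Ax nUx].
  have [k _ Fkx] := AF x Ax; exists k => //= kN; apply: nUx; rewrite UE; by exists k.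
apply: (@le_trans _ _ (leb (V `\` A))).
  apply: le_measure; rewrite ?inE; try exact: measurableD.
  by apply: setSD => x; rewrite UE => -[k _ Fkx]; exists k.
have VE : (leb V = leb A + leb (V `\` A))%E.
  by rewrite (measureDI leb mV mA) addeC; congr (_ + _)%E; rewrite setIidr.
have : (leb A + leb (V `\` A) <= leb A + e%:E)%E.
  rewrite -VE (le_trans _ (ltW Fe))//.
  exact: (outer_measure_sigma_subadditive (mu_ext (@wlength R idfun)) F).
by rewrite leeD2lE.
Qed.

(** * The lower bound and its sharpness *)

Section lower_bound.
Context {R : realType}.
Variable n : nat.
Hypothesis n_ge2 : (2 <= n)%N.
Notation mu := (@leb R).
Implicit Types (m k : nat) (A : set (lebesgueType R)).

Let n_gt0 : (0 < n)%N. Proof. exact: ltnW n_ge2. Qed.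
Let nX_gt0 m : 0 < n%:R ^+ m :> R. Proof. by rewrite exprn_gt0// ltr0n. Qed.

Lemma atom00 : atom n 0 0 = unit_itv :> set R.
Proof. by rewrite /atom expr0 !divr1. Qed.

Lemma density00 A (x : R) : A `<=` unit_itv -> mu A = x%:E -> density n A 0 0 = x.
Proof.
by move=> AD Ax; rewrite /density expr0 mul1r atom00 setIidl// Ax.
Qed.

Lemma sum_density A m : measurable A ->
  \sum_(k < n ^ m) density n A m k / n%:R ^+ m = density n A 0 0.
Proof.
move=> mA; elim: m => [|m IH]; first by rewrite big_ord1 expr0 divr1.
rewrite -IH -!mulr_suml expnSr sum_nat_mul.
under eq_bigr do rewrite -density_mean//.
by rewrite -mulr_sumr exprS invfM mulrACA divff ?mul1r// pnatr_eq0 -lt0n.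
Qed.

Lemma sum_density_le A m (e : R) : measurable A -> (mu A <= e%:E)%E ->
  \sum_(k < n ^ m) density n A m k / n%:R ^+ m <= e.
Proof.
move=> mA Ae; rewrite sum_density// -lee_fin -[X in X%:E]divr1 -[1](expr0 n%:R).
rewrite -(densityK n_gt0 mA) (le_trans _ Ae)// le_measure ?inE//.
by apply: measurableI => //; exact: measurable_atom.
Qed.

(** An atom is convex, so an endpoint separating two of its points would lie in it and have index
    [k]. *)
Lemma atom_itvoc_decided m k (a b : R) : digits n m a != k -> digits n m b != k ->
  atom n m k `<=` `]a, b] \/ atom n m k `&` `]a, b] = set0.
Proof.
move=> ak bk.
have [[x [kx]]|h] := pselect (exists x, atom n m k x /\ (x \in `]a, b])); last first.
  by right; rewrite -subset0 => x [kx abx]; apply: h; exists x.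
rewrite in_itv/= => /andP[ax xb]; left => y ky.
have btw (c u v : R) : atom n m k u -> atom n m k v -> u <= c <= v -> digits n m c = k.
  move=> /(atomP n_gt0)/andP[ku _] /(atomP n_gt0)/andP[_ kv] /andP[uc cv].
  apply: (atom_digits n_gt0); apply/(atomP n_gt0); apply/andP; split.
    exact: (le_trans ku (ler_wpM2l (ltW (nX_gt0 m)) uc)).
  exact: (le_lt_trans (ler_wpM2l (ltW (nX_gt0 m)) cv) kv).
rewrite /= in_itv/=; apply/andP; split.
  rewrite ltNge; apply/negP => ya; move: ak; rewrite (btw a y x) ?eqxx//.
  by rewrite ya ltW.
rewrite leNgt; apply/negP => /ltW yb; move: bk; rewrite (btw b x y) ?eqxx//.
by rewrite xb.
Qed.

Lemma sum_digits_eq m (x : R) : \sum_(k < n ^ m) ((digits n m x == k)%:R : R) <= 1.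
Proof.
have [h|h] := ltnP (digits n m x) (n ^ m).
  rewrite (bigD1 (Ordinal h))//= eqxx big1 ?addr0// => i.
  by rewrite -val_eqE/= eq_sym => /negbTE ->.
rewrite big1 ?ler01// => i _; case: eqP => // E.
by have := ltn_ord i; rewrite -E ltnNge h.
Qed.

(** Up to e/3 on each side, [A] is a union [U] of [N] intervals. Atoms free of endpoints are inside
    [U] or disjoint from it; those with endpoints contribute at most 2N/n^m, and [m] makes this at
    most e/3. *)
Lemma dist_density_small A (e : R) : measurable A -> A `<=` unit_itv -> 0 < e ->
  exists m, \sum_(k < n ^ m) Num.min (density n A m k) (1 - density n A m k) / n%:R ^+ m <= e.
Proof.
move=> mA AD e0.
have Aoo : (mu A < +oo)%E.
  rewrite (@le_lt_trans _ _ 1%:E) ?ltry// -(@leb_unit_itv R) le_measure ?inE//.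
  exact: measurable_unit_itv.
have e3 : 0 < e / 3 by rewrite divr_gt0.
have [N [a [b]]] := interval_cover mA Aoo e3.
set U : set (lebesgueType R) := \bigcup_(i in _) _ => /= -[AU UA].
have mU : measurable U by apply: bigcup_measurable => i _; exact: measurable_leb_itv.
have mAU : measurable (A `\` U) by exact: measurableD.
have mUA : measurable (U `\` A) by exact: measurableD.
have [m hm] : exists m, 2 * N%:R / n%:R ^+ m <= e / 3.
  exists (Num.truncn (2 * N%:R / (e / 3))).+1.
  rewrite ler_pdivrMr// [e / 3 * _]mulrC -ler_pdivrMr//.
  rewrite ltW// (lt_trans (truncnS_gt _))// -natrX ltr_nat; exact: ltn_expl.
exists m.
pose ends k : R := \sum_(i < N) ((digits n m (a i) == k)%:R + (digits n m (b i) == k)%:R).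
have ends0 k : 0 <= ends k by apply: sumr_ge0 => i _; rewrite addr_ge0.
have key k : Num.min (density n A m k) (1 - density n A m k) <=
    density n (A `\` U) m k + density n (U `\` A) m k + ends k.
  have d1 := density_ge0 n_gt0 (A `\` U) m k.
  have d2 := density_ge0 n_gt0 (U `\` A) m k.
  have d3 := density_ge0 n_gt0 A m k.
  have [/existsP[i hi]|/existsPn h] := boolP [exists i : 'I_N,
      (digits n m (a i) == k) || (digits n m (b i) == k)].
    have : 1 <= ends k.
      rewrite /ends (bigD1 i)//= -[X in X <= _]addr0 lerD//; last first.
        by apply: sumr_ge0 => j _; rewrite addr_ge0.
      by case/orP : hi => ->; rewrite ?lerDl ?lerDr.
    by move=> h; rewrite ge_min; apply/orP; right; lra.
  have mI (B : set (lebesgueType R)) : measurable B ->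
      measurable (B `&` atom n m k : set (lebesgueType R)).
    by move=> mB; apply: measurableI => //; exact: measurable_atom.
  (* Inside [U], the part of the atom missing from [A] lies in [U] minus [A]; outside [U], its part
     in [A] lies in [A] minus [U]. *)
  have [[i [iN ki]]|no] := pselect (exists i, (i < N)%N /\ atom n m k `<=` `]a i, b i]).
    rewrite ge_min; apply/orP; right.
    suff : 1 <= density n A m k + density n (U `\` A) m k by have := ends0 k; lra.
    have : (mu (atom n m k) <= mu (A `&` atom n m k) + mu ((U `\` A) `&` atom n m k))%E.
      apply: (le_trans _ (measureU2 mu (mI _ mA) (mI _ mUA))).
      apply: le_measure; rewrite ?inE.
      - exact: measurable_atom.
      - by apply: measurableU; exact: mI.
      - move=> x kx; have [Ax|nAx] := pselect (A x); first by left.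
        by right; split => //; split => //; exists i => //; exact: ki.
    rewrite (leb_atom n_gt0) !(densityK n_gt0)// -EFinD lee_fin -mulrDl.
    by rewrite ler_pdivlMr// mulVf// gt_eqF.
  rewrite ge_min; apply/orP; left.
  suff : density n A m k <= density n (A `\` U) m k by have := ends0 k; lra.
  have : (mu (A `&` atom n m k) <= mu ((A `\` U) `&` atom n m k))%E.
    apply: le_measure; rewrite ?inE; try exact: mI.
    move=> x [Ax kx]; split => //; split => // -[i /= iN abx].
    have := h (Ordinal iN); rewrite negb_or/= => /andP[ha hb].
    have [ki|] := atom_itvoc_decided ha hb; first by apply: no; exists i.
    by rewrite -subset0 => /(_ x); apply.
  by rewrite !(densityK n_gt0)// lee_fin ler_pM2r// invr_gt0.
apply: (@le_trans _ _ (\sum_(k < n ^ m) (density n (A `\` U) m k / n%:R ^+ m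
    + density n (U `\` A) m k / n%:R ^+ m + ends k / n%:R ^+ m))).
  by apply: ler_sum => k _; rewrite -!mulrDl ler_wpM2r// invr_ge0 ltW.
rewrite !big_split/=.
have s1 := sum_density_le m mAU AU.
have s2 := sum_density_le m mUA UA.
suff : \sum_(k < n ^ m) ends k / n%:R ^+ m <= e / 3 by lra.
apply: (le_trans _ hm); rewrite -mulr_suml ler_wpM2r ?invr_ge0 ?(ltW (nX_gt0 _))//.
rewrite /ends exchange_big/= (@le_trans _ _ (\sum_(i < N) 2))//.
  apply: ler_sum => i _; rewrite big_split/=.
  have := sum_digits_eq m (a i); have := sum_digits_eq m (b i); lra.
by rewrite sumr_const card_ord -[leLHS]mulr_natr.
Qed.

(** * Averages of omega over the densities *)

Definition omega_mass A m : R := \sum_(k < n ^ m) omega n (density n A m k) / n%:R ^+ m.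

(** This is [omega_mean] for each interval of level [m] and its n children, divided by n^(m+1). *)
Lemma omega_massS A m : measurable A ->
  omega_mass A m <= omega_mass A m.+1 + diff_norm n A m.+1.
Proof.
move=> mA; rewrite /omega_mass /diff_norm /= expnSr.
rewrite (sum_nat_mul (fun k => omega n (density n A m.+1 k) / n%:R ^+ m.+1)).
rewrite (sum_nat_mul (fun k =>
  `|density n A m.+1 k - density n A m (k %/ n)| / n%:R ^+ m.+1)) -big_split/=.
apply: ler_sum => k _; rewrite -big_split/=.
under eq_bigr do rewrite divnMDl// divn_small// addn0 -mulrDl.
rewrite -mulr_suml big_split/=.
have := @omega_mean _ _ n_ge2 (fun j => density n A m.+1 (k * n + j)%N).
have n0 : n%:R != 0 :> R by rewrite pnatr_eq0 -lt0n.
rewrite -(density_mean n_gt0 mA) mulrAC divff// mul1r.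
move=> /(_ (fun j => density_ge0 n_gt0 _ _ _)) h.
rewrite exprSr invfM [n%:R ^- m / _]mulrC mulrA ler_wpM2r ?invr_ge0 ?(ltW (nX_gt0 _))//.
by rewrite ler_pdivlMr ?ltr0n// mulrC.
Qed.

Lemma omega_mass_sum A m : measurable A ->
  omega_mass A 0 <= omega_mass A m + \sum_(1 <= i < m.+1) diff_norm n A i.
Proof.
move=> mA; elim: m => [|m IH]; first by rewrite big_geq// addr0.
rewrite big_nat_recr//= (le_trans IH)//.
have := omega_massS m mA; lra.
Qed.

Lemma omega_mass_small A (e : R) : measurable A -> A `<=` unit_itv -> 0 < e ->
  exists m, omega_mass A m <= e.
Proof.
move=> mA AD e0.
have e2 : 0 < e / 2 by rewrite divr_gt0.
have [K hK] : exists K, n%:R ^- K <= e / 2.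
  exists (Num.truncn (e / 2)^-1).+1.
  rewrite -[leRHS]invrK lef_pV2 ?posrE ?invr_gt0//.
  rewrite ltW// (lt_trans (truncnS_gt _))// -natrX ltr_nat; exact: ltn_expl.
(* Half of [e] is for n^-K, the other half for [K] times the mean distance of the densities to {0,
   1}; dividing by [K.+1] covers K = 0. *)
have eK : 0 < e / 2 / K.+1%:R by rewrite divr_gt0.
have [m hm] := dist_density_small mA AD eK.
exists m; rewrite /omega_mass.
apply: (@le_trans _ _ (\sum_(k < n ^ m) (K%:R *
   (Num.min (density n A m k) (1 - density n A m k) / n%:R ^+ m) + n%:R ^- K / n%:R ^+ m))).
  apply: ler_sum => k _; rewrite mulrA -mulrDl ler_wpM2r ?invr_ge0 ?(ltW (nX_gt0 _))//.
  have h0 := omega_near0 n_ge2 K (density_ge0 n_gt0 A m k).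
  have h1 := omega_near1 n_ge2 K (density_le1 n_gt0 mA m k).
  by rewrite /Num.min; case: ifP.
rewrite big_split/= -mulr_sumr sumr_const card_ord -[X in _ + X]mulr_natr natrX divfK ?gt_eqF//.
rewrite [e](splitr e) lerD//.
apply: (@le_trans _ _ (K%:R * (e / 2 / K.+1%:R))); first by rewrite ler_wpM2l.
rewrite mulrC mulrAC ler_pdivrMr// ler_wpM2l ?(ltW e2)//.
by rewrite ler_nat.
Qed.

Lemma omega_le_S1 A (x : R) : measurable A -> A `<=` unit_itv -> mu A = x%:E ->
  ((omega n (xstar x))%:E <= L1norm (S1 n (\1_A : R -> R)))%E.
Proof.
move=> mA AD Ax; rewrite omega_xstar// L1norm_S1//.
have d0 m : 0 <= diff_norm n A m.
  by apply: sumr_ge0 => k _; rewrite divr_ge0// ltW.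
apply/lee_addgt0Pr => e e0.
have [m hm] := omega_mass_small mA AD e0.
have : omega n x <= e + \sum_(1 <= i < m.+1) diff_norm n A i.
  have := omega_mass_sum m mA.
  rewrite [X in X <= _]/omega_mass big_ord1 expr0 divr1 (density00 AD Ax).
  by move=> h; rewrite (le_trans h)// lerD2r.
rewrite -lee_fin EFinD addeC => /le_trans; apply; rewrite leeD2r//.
rewrite -sumEFin (nneseries_split 1 m)//; last by move=> i _; rewrite lee_fin.
by rewrite add1n leeDl// nneseries_ge0// => i _ _; rewrite lee_fin.
Qed.

(** * The intervals starting at 0 *)

Notation first_atom k := (@atom R n k 0).

Lemma atom_ancestor m d i : @atom R n (m + d) i `<=` atom n m (i %/ n ^ d).
Proof.
elim: d i => [|d IH] i; first by rewrite addn0 divn1.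
rewrite addnS expnS divnMA; apply: subset_trans (IH _); exact: atomS.
Qed.

Lemma density_first_coarse k m j : (m <= k)%N ->
  density n (first_atom k) m j = (j == 0)%N%:R * (n%:R ^+ m / n%:R ^+ k).
Proof.
move=> mk; have sub : first_atom k `<=` first_atom m.
  by have := @atom_ancestor m (k - m) 0; rewrite subnKC// div0n.
rewrite /density; case: eqP => [->|/eqP j0].
  by rewrite setIidl// leb_atom//= mul1r.
rewrite (_ : _ `&` _ = set0) ?measure0 ?mulr0 ?mul0r//.
rewrite -subset0 => x [/sub /(atom_digits n_gt0) x0 /(atom_digits n_gt0) xj].
by move: j0; rewrite -xj x0.
Qed.

Lemma density_first_fine k d j :
  density n (first_atom k) (k + d) j = (j %/ n ^ d == 0)%N%:R.
Proof.
rewrite /density; have sub := @atom_ancestor k d j.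
case: eqP => [j0|/eqP j0].
  rewrite j0 in sub.
  by rewrite setIidr// leb_atom//= mulfV// gt_eqF.
rewrite (_ : _ `&` _ = set0) ?measure0 ?mulr0//.
rewrite -subset0 => x [/(atom_digits n_gt0) x0 /sub /(atom_digits n_gt0) xj].
by move: j0; rewrite -xj x0.
Qed.

(** From level [k] on all densities are 0 or 1, and children inherit the density of their parent. *)
Lemma diff_norm_first_fine k d : diff_norm n (first_atom k) (k + d).+1 = 0.
Proof.
rewrite /diff_norm big1// => i _ /=.
have := density_first_fine k d.+1 i; rewrite addnS => ->.
by rewrite density_first_fine -divnMA -expnS subrr normr0 mul0r.
Qed.

Lemma diff_norm_first_coarse k m : (m < k)%N ->
  diff_norm n (first_atom k) m.+1 = 2 * (n%:R - 1) / n%:R * n%:R ^- k.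
Proof.
move=> mk; rewrite /diff_norm -mulr_suml expnSr.
rewrite (sum_nat_mul (fun i =>
  `|density n (first_atom k) m.+1 i - density n (first_atom k) m (i %/ n)|)).
have n1 : 1 <= n%:R :> R by rewrite ler1n.
pose q : R := n%:R ^+ m / n%:R ^+ k.
have q0 : 0 <= q by rewrite divr_ge0 ?(ltW (nX_gt0 _)).
(* Only the interval 0 has positive density q. Its first child has density n q and the n - 1 others
   0, which gives (n q - q) + (n - 1) q. *)
have E i : \sum_(j < n) `|density n (first_atom k) m.+1 (i * n + j) -
    density n (first_atom k) m ((i * n + j) %/ n)| = (i == 0)%N%:R * (2 * (n%:R - 1) * q).
  under eq_bigr do rewrite divnMDl// divn_small// addn0 density_first_coarse//
    density_first_coarse ?(ltnW mk)// exprS -mulrA -/q addn_eq0 muln_eq0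
    (gtn_eqF n_gt0) orbF.
  case: eqP => [_|_] /=; last first.
    by rewrite !mul0r subrr normr0 big1.
  rewrite !mul1r; move: n_gt0 n1; case: (n) => // n' _ n1.
  rewrite big_ord_recl/= mul1r (eq_bigr (fun=> q)); last first.
    by move=> j _; rewrite mul0r sub0r normrN ger0_norm.
  rewrite sumr_const card_ord -[q *+ n']mulr_natl -natr1 ger0_norm; first by ring.
  by rewrite subr_ge0 ler_peMl// natr1.
under eq_bigr do rewrite E.
rewrite -mulr_suml.
have -> : \sum_(i < n ^ m) ((nat_of_ord i == 0)%N%:R : R) = 1.
  have : (0 < n ^ m)%N by rewrite expn_gt0 n_gt0.
  case: (n ^ m)%N => // N _.
  by rewrite big_ord_recl/= big1 ?addr0.
rewrite mul1r /q exprS; have := gt_eqF (nX_gt0 m); have := gt_eqF (nX_gt0 k).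
have : n%:R != 0 :> R by rewrite pnatr_eq0 -lt0n.
move: (n%:R ^+ m) (n%:R ^+ k) => u v h0 h1 h2; field.
by rewrite h0 h1 h2.
Qed.

(** The first [k] differences have the same norm 2 (n - 1)/n times n^-k and the others vanish, while
    omega(n^-k) = k n^-k. *)
Lemma L1norm_first k : L1norm (S1 n (\1_(`[0, n%:R ^- k[%classic : set R) : R -> R)) =
  (2 * (n%:R - 1) / n%:R * omega n (n%:R ^- k))%:E.
Proof.
have -> : `[0, n%:R ^- k[%classic = first_atom k by rewrite /atom mul0r div1r.
rewrite (L1norm_S1 n_gt0 (measurable_atom n k 0)).
rewrite (nneseries_split 1 k); last first.
  by move=> i _; rewrite lee_fin sumr_ge0// => j _; rewrite divr_ge0// ltW.
rewrite [X in (_ + X)%E]eseries0 ?adde0; last first.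
  move=> i; rewrite add1n => ki _; have -> : i = (k + (i - k.+1)).+1 by lia.
  by rewrite diff_norm_first_fine.
rewrite add1n big_add1/= big_nat.
rewrite (eq_bigr (fun=> (2 * (n%:R - 1) / n%:R * n%:R ^- k)%:E)); last first.
  by move=> i /andP[_ ik]; rewrite diff_norm_first_coarse.
rewrite -big_nat sumEFin sumr_const_nat subn0 omega_pow//; congr (_%:E).
by rewrite -[LHS]mulr_natl; ring.
Qed.

End lower_bound.

Theorem theorem2p6 (R : realType) :
  (forall n : nat, (2 <= n)%N ->
    [/\ (forall (A : set (lebesgueType R)) (x : R),
           measurable A -> A `<=` unit_itv -> leb A = x%:E ->
           ((omega n (xstar x))%:E <= L1norm (S1 n (\1_A : R -> R)))%E),
        (exists c C : R, [/\ 0 < c, c <= C &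
           forall x : R, 0 < x -> x < 1 ->
             c * (xstar x * ln (xstar x)^-1) <= omega n (xstar x) /\
             omega n (xstar x) <= C * (xstar x * ln (xstar x)^-1)]) &
        (exists c : R, forall k : nat, (1 <= k)%N ->
           L1norm (S1 n (\1_(`[0, n%:R ^- k[%classic : set R) : R -> R)) =
           (c * omega n (n%:R ^- k))%:E)])
  /\ (forall x : R, 0 <= x -> x <= 1 -> omega 2 x = takagi x).
Proof.
split=> [n n2|x _ _]; last exact: omega2_takagi.
split; first by move=> A x; exact: omega_le_S1.
  exact: omega_asymp.
by exists (2 * (n%:R - 1) / n%:R) => k _; exact: L1norm_first.
Qed.
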